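(* Let $L$ be an ordered (classical or virtual) tangle on $n$ strings and let $1\le j<i_1<i_2<\dots<i_r\le n$, $I=\{i_1,\dots,i_r\}$. Then $$Z_{I,j}(L)=\mu_{i_1i_2\dots i_r,j}(L).$$
   Context: **Tangles and Gauss diagrams.** Let $D^2$ be a disk in the $xy$-plane with prescribed interior points $p_1,p_2,\dots$ on the $x$-axis, and $C=D^2\times[0,1]$. An ordered, oriented $(k,l)$-tangle is an ordered collection of $n=\frac12(k+l)$ disjoint oriented intervals (strings) properly embedded in $C$ with endpoints in $\{p_i\}_{i=1}^k\times\{1\}\cup\{p_i\}_{i=1}^l\times\{0\}$ (no closed components), up to oriented isotopy of $C$ fixed on the boundary. The Gauss diagram of a tangle diagram (generic projection to the $xz$-plane) is an ordered collection of $n$ oriented intervals with the two preimages of each crossing joined by an arrow from the over-passing to the under-passing point, carrying the sign $\pm1$ (local writhe) of the crossing. A virtual tangle is an equivalence class of abstract Gauss diagrams (any ordered collection of $n$ oriented intervals with signed arrows) modulo the Reidemeister moves of Gauss diagrams. **Tree invariants.** An arrow diagram on $n$ strings is an ordered set of $n$ oriented intervals with several unsigned arrows connecting pairs of distinct points on them, up to orientation-preserving diffeomorphism of the intervals. For an arrow diagram $A$ and a Gauss diagram $G$ on $n$ strings, $\langle A,G\rangle=\sum_{\phi:A\to G}\operatorname{sign}(\phi)$, where $\phi$ runs over embeddings mapping the $i$-th string to the $i$-th string and arrows to arrows, preserving orientations, and $\operatorname{sign}(\phi)=\prod_{a\in A}\operatorname{sign}(\phi(a))$. For $j\in\{1,\dots,n\}$,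 $I\subset\{1,\dots,n\}\setminus\{j\}$, a tree diagram with leaves on $I$ and trunk on $j$ is an arrow diagram such that: the tail and head of every arrow lie on different strings; there is exactly one arrow with tail on the $i$-th string if $i\in I$ and none if $i\notin I$; all arrowheads lie on strings in $I\cup\{j\}$; on each string $i\in I$ all arrowheads precede the unique arrowtail. Regard the diagram $A$ as a graph, remove strings not in $I\cup\{j\}$ and cut off the part of each string $i\in I$ after its arrowtail; the resulting graph $T_A$ is a tree with leaves at the beginnings of the strings in $I\cup\{j\}$ and root at the endpoint of the $j$-th string. $A$ is planar if $T_A$ can be drawn in the plane so that its leaves, counted clockwise from the root, appear in increasing order of indices. $\mathcal A_{I,j}$ is the set of planar tree diagrams with leaves on $I$ and trunk on $j$. $\operatorname{sign}(A)=(-1)^q$, $q$ being the number of right-pointing arrows (from the $p$-th to the $s$-th string with $p<s$). Then $Z_{I,j}(L)=\sum_{A\in\mathcal A_{I,j}}\operatorname{sign}(A)\langle A,G\rangle$ for any Gauss diagram $G$ of $L$ (known to be independent of $G$), and $Z_{\emptyset,j}=1$. **Milnor's $\mu$-invariants.** For a classical tangle let $\pi=\pi_1(C\setminus L)$; for a virtual tangle let $\pi$ be the (upper) tangle group of its Gauss diagram. In both cases $\pi$ has the Wirtinger presentation read off a Gauss diagram: generators are the arcs, i.e. the segments into which the arrowheads cut the strings; for each arrow of sign $\varepsilon$ with tail on the arc $a$ and head separating consecutive arcs $b$ (incoming) and $c$ (outgoing), there is the relation $c=a^{-\varepsilon}ba^{\varepsilon}$. The canonical meridian $m_i$ is the generator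 of the first arc of the $i$-th string (a small loop around the starting point of $L_i$ with $\operatorname{lk}(m_i,L_i)=+1$). The canonical parallel $l_j$ (a pushed-off copy of $L_j$ closed up along the boundary of $C$, with $\operatorname{lk}(l_j,L_j)=0$) is the product $a_1^{\varepsilon_1}a_2^{\varepsilon_2}\cdots a_s^{\varepsilon_s}$, where $a_1,\dots,a_s$ are the arcs carrying the tails of the arrows with heads on the $j$-th string, in the order in which the heads are met along the $j$-th string, and $\varepsilon_t$ are their signs, multiplied by the power of $m_j$ making the total exponent of $j$-th string arcs zero (this power does not affect the coefficients below with $j\notin\{i_1,\dots,i_r\}$). The reduced group $\tilde\pi$ is the quotient of $\pi$ by the relations $[m_i,w^{-1}m_iw]=1$ for all $i$ and all $w\in\pi$; similarly $\tilde F$ for the free group $F$ on $x_1,\dots,x_n$ (with $x_i$ in place of $m_i$). The map $x_i\mapsto m_i$ induces an isomorphism $\tilde F\cong\tilde\pi$. Let $\tilde Z$ be the quotient of the ring $\mathbb Z[[X_1,\dots,X_n]]$ of power series in non-commuting variables by the two-sided ideal generated by all monomials in which some $X_i$ occurs more than once. The Magnus expansion $x_i\mapsto 1+X_i$, $x_i^{-1}\mapsto 1-X_i+X_i^2-\cdots$ induces a ring homomorphism $\theta_L:\mathbb Z\tilde\pi\cong\mathbb Z\tilde F\to\tilde Z$. The invariants $\mu_{i_1\dots i_r,j}(L)$ (distinct indices $i_1,\dots,i_r,j$) are defined by $\theta_L(l_j)=\sum\mu_{i_1\dots i_r,j}X_{i_1}X_{i_2}\cdots X_{i_r}$. *)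

(* Defs.v *)
From mathcomp Require Import all_boot all_order all_algebra.
From mathcomp Require Import boolp classical_sets.

Set Implicit Arguments.
Unset Strict Implicit.
Unset Printing Implicit Defensive.

Import Order.TTheory GRing.Theory Num.Theory.

Local Open Scope ring_scope.

(** * Arrow diagrams and Gauss diagrams *)

(* [(i, p) : point n N] is the point at height [p] on the [i]-th of [n] oriented
   strings; the string runs in the direction of increasing [p].  An arrow is the
   pair of its tail and its head. *)
Definition point (n N : nat) : finType := ('I_n * 'I_N)%type.
Definition arrow (n N : nat) : finType := (point n N * point n N)%type.

Definition tail n N (a : arrow n N) : point n N := a.1.
Definition head n N (a : arrow n N) : point n N := a.2.
Definition endpt n N (h : bool) (a : arrow n N) : point n N :=
  if h then head a else tail a.

Definition below n N (p q : point n N) : bool := (p.1 == q.1) && (p.2 < q.2)%N.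

Definition distinct_ends n N (D : {set arrow n N}) : bool :=
  [forall a in D, forall b in D, forall s : bool, forall t : bool,
     (endpt s a == endpt t b) ==> (a == b) && (s == t)].

(* Only the order of the points of each string matters, so the diffeomorphism
   classes of arrow diagrams with at most [N] arrow ends on each string
   correspond bijectively to the sets of arrows [D] satisfying the predicate
   [arrow_diagram]: the heights used on every string are 0, 1, 2, etc. *)
Definition arrow_diagram n N (D : {set arrow n N}) : bool :=
  distinct_ends D &&
  [forall a in D, forall s : bool, forall q : point n N,
     below q (endpt s a) ==> [exists b in D, exists t : bool, endpt t b == q]].

Definition order_preserving n N M (D : {set arrow n N})
    (f : arrow n N -> arrow n M) : Prop :=
  forall a b, a \in D -> b \in D -> forall s t : bool,
    (endpt s (f a)).1 = (endpt s a).1 /\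
    below (endpt s (f a)) (endpt t (f b)) = below (endpt s a) (endpt t b).

(* Heights are not normalised here: isotopic Gauss diagrams are identified in
   [virtual_eq].  An arrow is positive when [gpos] is true; the value of [gpos]
   outside [garrows] is irrelevant. *)
Record gauss (n : nat) := Gauss {
  gheight : nat;
  garrows : {set arrow n gheight};
  gpos : arrow n gheight -> bool;
  gaussP : distinct_ends garrows
}.

Definition gsign n (G : gauss n) (a : arrow n (gheight G)) : int :=
  if gpos a then 1 else -1.

(** * Virtual tangles *)

Definition isotopic n N M (D : {set arrow n N}) (pos : arrow n N -> bool)
    (E : {set arrow n M}) (pos' : arrow n M -> bool) : Prop :=
  exists f : arrow n N -> arrow n M,
    [/\ f @: D = E, forall a, a \in D -> pos' (f a) = pos a
      & order_preserving D f].

Definition adjacent n N (D : {set arrow n N}) (p q : point n N) : bool :=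
  [&& p.1 == q.1, p != q &
   ~~ [exists a in D, exists s : bool,
         (below p (endpt s a) && below (endpt s a) q)
         || (below q (endpt s a) && below (endpt s a) p)]].

Definition Omega1 n (G G' : gauss n) : Prop :=
  exists2 a, a \in garrows G &
    adjacent (garrows G) (tail a) (head a) /\
    isotopic (garrows G :\ a) (@gpos n G) (garrows G') (@gpos n G').

Definition Omega2 n (G G' : gauss n) : Prop :=
  exists a b,
    [/\ [&& a \in garrows G, b \in garrows G & gpos a != gpos b],
        adjacent (garrows G) (tail a) (tail b),
        adjacent (garrows G) (head a) (head b)
      & isotopic (garrows G :\ a :\ b) (@gpos n G)
                 (garrows G') (@gpos n G')].

(* The arrows [tm], [tb], [mb] go from the top to the middle, from the top to
   the bottom and from the middle to the bottom strand of the triangle.  For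
   given signs, exactly two orders of the ends on the three strands, exchanged
   by the move, are realised by three straight lines in general position; they
   are told apart by [o]. *)
Definition Omega3 n (G G' : gauss n) : Prop :=
  exists tm tb mb : arrow n (gheight G),
  exists f : arrow n (gheight G) -> arrow n (gheight G'),
  let swapped (p q : point n (gheight G)) :=
    [|| (p, q) == (tail tm, tail tb), (p, q) == (tail tb, tail tm),
        (p, q) == (head tm, tail mb), (p, q) == (tail mb, head tm),
        (p, q) == (head tb, head mb) | (p, q) == (head mb, head tb)] in
  [/\ [&& tm \in garrows G, tb \in garrows G, mb \in garrows G & tm != mb],
      [&& adjacent (garrows G) (tail tm) (tail tb),
          adjacent (garrows G) (head tm) (tail mb)
        & adjacent (garrows G) (head tb) (head mb)],
      exists o : bool,
        [/\ below (tail tm) (tail tb) = (o == (gpos tm == gpos tb)),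
            below (head tm) (tail mb) = (o == (gpos tm == gpos mb))
          & below (head tb) (head mb) = (o == (gpos tb == gpos mb))],
      f @: garrows G = garrows G' /\
      (forall a, a \in garrows G -> gpos (f a) = gpos a)
    & forall a b, a \in garrows G -> b \in garrows G -> forall s t : bool,
        (endpt s (f a)).1 = (endpt s a).1 /\
        below (endpt s (f a)) (endpt t (f b)) =
          (if swapped (endpt s a) (endpt t b)
           then below (endpt t b) (endpt s a)
           else below (endpt s a) (endpt t b))].

Inductive virtual_eq n : gauss n -> gauss n -> Prop :=
| veq_isotopic G G' :
    isotopic (garrows G) (@gpos n G) (garrows G') (@gpos n G') ->
    virtual_eq G G'
| veq_Omega1 G G' : Omega1 G G' -> virtual_eq G G'
| veq_Omega2 G G' : Omega2 G G' -> virtual_eq G G'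
| veq_Omega3 G G' : Omega3 G G' -> virtual_eq G G'
| veq_sym G G' : virtual_eq G G' -> virtual_eq G' G
| veq_trans G G' G'' :
    virtual_eq G G' -> virtual_eq G' G'' -> virtual_eq G G''.

Record virtual_tangle (n : nat) := VirtualTangle {
  represents : gauss n -> Prop;
  virtual_tangleP :
    exists G, forall G', represents G' <-> virtual_eq G G'
}.

(** * Tree invariants *)

Definition is_embedding n N (A : {set arrow n N}) (G : gauss n)
    (phi : {ffun {a : arrow n N | a \in A} -> arrow n (gheight G)}) : bool :=
  [forall a, phi a \in garrows G] &&
  [forall a, forall b, forall s : bool, forall t : bool,
     ((endpt s (phi a)).1 == (endpt s (val a)).1) &&
     (below (endpt s (phi a)) (endpt t (phi b))
        == below (endpt s (val a)) (endpt t (val b)))].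

Definition pairing n N (A : {set arrow n N}) (G : gauss n) : int :=
  \sum_(phi : {ffun {a : arrow n N | a \in A} -> arrow n (gheight G)}
         | is_embedding phi) \prod_a gsign (phi a).

Definition tree_diagram n N (I : {set 'I_n}) (j : 'I_n)
    (A : {set arrow n N}) : bool :=
  [&& arrow_diagram A,
      [forall a in A, (tail a).1 != (head a).1],
      [forall i, #|[set a in A | (tail a).1 == i]| == (i \in I)],
      [forall a in A, (head a).1 \in j |: I],
      [forall a in A, forall b in A,
         ((head a).1 == (tail b).1) ==> below (head a) (tail b)]
    & (* The graph [T_A] is a tree rooted at the end of string [j].  The
         previous conditions alone allow cycles of arrows away from [j]. *)
      [forall i in I,
         connect [rel p q | [exists a in A,
                               ((tail a).1 == p) && ((head a).1 == q)]] i j]].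

(* [leaf_order A i k u]: the part of [T_A] that flows into the point of height
   [k] of string [i] can be drawn in the plane so that [u] is the sequence of
   its leaves, listed clockwise from that point.  At an arrowhead the two
   incoming branches may be drawn in either order. *)
Inductive leaf_order n N (A : {set arrow n N}) : 'I_n -> nat -> seq 'I_n -> Prop :=
| LeafStart i k :
    (forall a, a \in A -> ~ ((head a).1 = i /\ ((head a).2 < k)%N)) ->
    leaf_order A i k [:: i]
| LeafFork a k u v w :
    a \in A -> ((head a).2 < k)%N ->
    (forall b, b \in A -> (head b).1 = (head a).1 -> ((head b).2 < k)%N ->
       ((head b).2 <= (head a).2)%N) ->
    leaf_order A (head a).1 (head a).2 u ->
    leaf_order A (tail a).1 (tail a).2 v ->
    w = u ++ v \/ w = v ++ u ->
    leaf_order A (head a).1 k w.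

Definition planar n N (A : {set arrow n N}) (j : 'I_n) : Prop :=
  exists2 u, leaf_order A j N u & sorted (fun a b : 'I_n => (a < b)%N) u.

(* A tree diagram has [#|I| < n] arrows, whose two ends lie on different
   strings, so there are fewer than [n] arrow ends on each string and the height
   bound [n] loses nothing. *)
Definition planar_trees n (I : {set 'I_n}) (j : 'I_n) : {set {set arrow n n}} :=
  [set A | tree_diagram I j A && `[< planar A j >]].

Definition tree_sign n N (A : {set arrow n N}) : int :=
  (-1) ^+ #|[set a in A | ((tail a).1 < (head a).1)%N]|.

Definition Z n (I : {set 'I_n}) (j : 'I_n) (G : gauss n) : int :=
  \sum_(A in planar_trees I j) tree_sign A * pairing A G.

(** * Groups given by generators and relations *)

(* [(x, true)] stands for [x] and [(x, false)] for its inverse. *)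
Definition word (X : Type) := seq (X * bool).

Definition winv X (w : word X) : word X := rev [seq (l.1, ~~ l.2) | l <- w].

Definition wmap X Y (f : X -> Y) (w : word X) : word Y :=
  [seq (f l.1, l.2) | l <- w].

Definition wcomm X (u v : word X) : word X := winv u ++ winv v ++ u ++ v.

(* [pres_eq R u v]: the words [u] and [v] are equal in the group generated by
   [X] subject to the relations [R]. *)
Inductive pres_eq X (R : word X -> word X -> Prop) : word X -> word X -> Prop :=
| pres_rel u v : R u v -> pres_eq R u v
| pres_cancel x e : pres_eq R [:: (x, e); (x, ~~ e)] [::]
| pres_cat u u' v v' :
    pres_eq R u u' -> pres_eq R v v' -> pres_eq R (u ++ v) (u' ++ v')
| pres_refl u : pres_eq R u u
| pres_sym u v : pres_eq R u v -> pres_eq R v u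
| pres_trans u v w : pres_eq R u v -> pres_eq R v w -> pres_eq R u w.

(** * The tangle group *)

(* The first arc of a string is named by the string, any other arc by the arrow
   whose head it starts at. *)
Definition arc n (G : gauss n) : Type :=
  ('I_n + {a : arrow n (gheight G) | a \in garrows G})%type.

(* The arc arriving at the point [p]; it contains [p] unless [p] is an
   arrowhead. *)
Definition arc_to n (G : gauss n) (p : point n (gheight G)) : arc G :=
  if [pick a : {a | a \in garrows G} |
        below (head (val a)) p &&
        [forall b in garrows G, below (head b) p ==>
           ((head b).2 <= (head (val a)).2)%N]] is Some a
  then inr a else inl p.1.

Definition meridian n (G : gauss n) (i : 'I_n) : arc G := inl i.

Inductive wirtinger n (G : gauss n) : word (arc G) -> word (arc G) -> Prop :=
| Wirtinger (a : {a | a \in garrows G}) :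
    let over := arc_to (tail (val a)) in
    let eps := gpos (val a) in
    wirtinger [:: (inr a, true)]
      [:: (over, ~~ eps); (arc_to (head (val a)), true); (over, eps)].

(* The relations of the reduced tangle group. *)
Inductive reduced n (G : gauss n) : word (arc G) -> word (arc G) -> Prop :=
| reduced_wirtinger u v : wirtinger u v -> reduced u v
| reduced_comm (i : 'I_n) (w : word (arc G)) :
    let m := [:: (meridian G i, true)] in
    reduced (wcomm m (winv w ++ m ++ w)) [::].

Definition heads_on n (G : gauss n) (j : 'I_n) : seq (arrow n (gheight G)) :=
  sort (fun a b => ((head a).2 <= (head b).2)%N)
    [seq a <- enum (garrows G) | (head a).1 == j].

Definition arc_string n (G : gauss n) (x : arc G) : 'I_n :=
  match x with inl i => i | inr a => (head (val a)).1 end.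

Definition wpow X (x : X) (z : int) : word X := nseq `|z|%N (x, 0 <= z).

Definition parallel n (G : gauss n) (j : 'I_n) : word (arc G) :=
  [seq (arc_to (tail a), gpos a) | a <- heads_on G j] ++
  wpow (meridian G j)
    (- \sum_(a <- heads_on G j | arc_string (arc_to (tail a)) == j) gsign a).

(** * Magnus expansion and Milnor's invariants *)

(* A power series in non-commuting variables is the function giving the
   coefficient of each monomial [X_i1 X_i2 ... X_ir], encoded as the sequence
   [:: i1; i2; ...; ir]. *)
Definition series (n : nat) := seq 'I_n -> int.

Definition series1 n : series n := fun m => (m == [::])%:R.

Definition series_mul n (f g : series n) : series n :=
  fun m => \sum_(k < (size m).+1) f (take k m) * g (drop k m).

Definition magnus_letter n (l : 'I_n * bool) : series n :=
  fun m => if l.2 then (m == [::])%:R + (m == [:: l.1])%:R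
           else (m == nseq (size m) l.1)%:R * (-1) ^+ size m.

Definition magnus n (w : word 'I_n) : series n :=
  foldr (fun l f => series_mul (magnus_letter l) f) (@series1 n) w.

(* The series whose monomials all have a repeated letter form the ideal by which
   the ring of power series is divided, so a class of the quotient is given by
   its coefficients at the monomials without repeated letters. *)
Definition modulo_repeats n (f : series n) : series n :=
  fun m => if uniq m then f m else 0.

(* The preimage of an element of the reduced tangle group in the reduced free
   group, under the isomorphism sending [x_i] to the meridian [m_i]. *)
Definition in_meridians n (G : gauss n) (u : word (arc G)) : word 'I_n :=
  xget [::] (fun w => pres_eq (@reduced n G) (wmap (meridian G) w) u).

Definition theta n (G : gauss n) (u : word (arc G)) : series n :=
  modulo_repeats (magnus (in_meridians u)).

(* [mu s j G] is [mu_{i1...ir,j}] for [s = [:: i1; ...; ir]]. *)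
Definition mu n (s : seq 'I_n) (j : 'I_n) (G : gauss n) : int :=
  theta (parallel G j) s.

(* Main.v *)
Require Import Defs.
From mathcomp Require Import all_boot all_order all_algebra.
From HB Require Import structures.
From mathcomp Require Import boolp.
From mathcomp Require classical_sets.
Import Defs.

(* Put [Phi(x) = 1 + D_x] for the Magnus expansion of the conjugate of a meridian
   named by an arc [x].  The Wirtinger relation at an arrow of sign [e] from [a]
   to [b], [c] reads [D_c = (1 - e D_a) D_b (1 + e D_a)].  Each [D_x] has no
   constant term, so these equations determine [D] degree by degree, and the
   resulting [Phi] respects all relations of the reduced group.  As the meridians
   generate the reduced group, [mu] is a coefficient of [Phi(l_j)], which is also
   the coefficient of [X_j X_i1 ... X_ir] in the series [D] of the end of string
   [j].

   Expanding, the coefficients satisfy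
     D_c[m] = D_b[m] + e sum_(m = uv) (D_b[u] D_a[v] - D_a[u] D_b[v]).
   Cutting a planar tree at the last arrowhead on its trunk gives the same
   recursion for the signed number of planar trees with leaves [m]: for increasing
   [m], a branch to the right of the trunk arrives by a left-pointing arrow and a
   branch to its left by a right-pointing one. *)

Set Implicit Arguments.
Unset Strict Implicit.
Unset Printing Implicit Defensive.

Import Order.TTheory GRing.Theory Num.Theory.

Local Open Scope ring_scope.

(** Two definitions stand in the way of a direct comparison. [theta] reads the parallel through a
    word in the meridians selected by [xget], so such a word must exist and its coefficients must
    not depend on the selection. The latter holds because [Phi] is defined on the whole reduced
    group and restricts to the Magnus expansion on words in the meridians. Existence is Milnor's
    argument: conjugates of one meridian commute, so a conjugator matters only modulo that meridian.
    On the other side [Z] sums over abstract diagrams together with their embeddings. Such a pair is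
    determined by its image, so the sum becomes one over sets of arrows of [G], which can be cut and
    joined without renumbering heights. The trunk of a branch may stand anywhere among the leaves of
    the branch. The comparison is therefore made for every trunk and every increasing monomial, with
    the trunk counted as a letter; the order of the indices in the theorem is what makes [j :: s]
    increasing. *)

Section SeriesMul.
Variable n : nat.
Implicit Types (f g h : series n) (m : seq 'I_n).

Lemma series_mul_nil f g : series_mul f g [::] = f [::] * g [::].
Proof. by rewrite /series_mul big_ord_recl big_ord0 addr0. Qed.

Lemma series_mul_cons f g x m :
  series_mul f g (x :: m) =
  f [::] * g (x :: m) + series_mul (fun m' => f (x :: m')) g m.
Proof. by rewrite /series_mul big_ord_recl. Qed.

Lemma eq_series_mul f f' g g' m :
  (forall k, f (take k m) = f' (take k m)) ->
  (forall k, g (drop k m) = g' (drop k m)) ->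
  series_mul f g m = series_mul f' g' m.
Proof. by move=> ff gg; apply: eq_bigr => k _; rewrite ff gg. Qed.

Lemma series_mulDl f f' g m :
  series_mul (fun m' => f m' + f' m') g m =
  series_mul f g m + series_mul f' g m.
Proof. by rewrite -big_split; apply: eq_bigr => k _; rewrite mulrDl. Qed.

Lemma series_mulDr f g g' m :
  series_mul f (fun m' => g m' + g' m') m =
  series_mul f g m + series_mul f g' m.
Proof. by rewrite -big_split; apply: eq_bigr => k _; rewrite mulrDr. Qed.

Lemma series_mulZl c f g m :
  series_mul (fun m' => c * f m') g m = c * series_mul f g m.
Proof. by rewrite [RHS]mulr_sumr; apply: eq_bigr => k _; rewrite mulrA. Qed.

Lemma series_mulA f g h m :
  series_mul f (series_mul g h) m = series_mul (series_mul f g) h m.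
Proof.
elim: m f => [|x m IHm] f; first by rewrite !series_mul_nil mulrA.
rewrite !series_mul_cons series_mul_nil IHm.
rewrite [in RHS](@eq_series_mul _
  (fun m' => f [::] * g (x :: m') + series_mul (fun m2 => f (x :: m2)) g m') _ h)//.
  by rewrite series_mulDl series_mulZl mulrDr mulrA addrA.
by move=> k; rewrite series_mul_cons.
Qed.

Lemma series_mul1l f m : series_mul (@series1 n) f m = f m.
Proof.
rewrite /series_mul big_ord_recl take0 drop0 /series1 mul1r big1 => [|i _].
  exact: addr0.
by case: m i => [[]//|x m i]; rewrite /= mul0r.
Qed.

Lemma series_mul1r f m : series_mul f (@series1 n) m = f m.
Proof.
rewrite /series_mul big_ord_recr take_size drop_size /series1 mulr1.
rewrite big1 => [|i _]; first exact: add0r.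
rewrite /= -size_eq0 size_drop subn_eq0 leqNgt ltn_ord.
exact: mulr0.
Qed.

End SeriesMul.

(* The ring of the reduced Magnus expansion, times a copy of the integers for
   each monomial with a repeated letter; the second factor only serves to have
   all functions as elements. *)
Definition rseries (n : nat) : Type := seq 'I_n -> int.

(** * The reduced series ring and the ideals of its variables *)

Section ReducedSeries.
Variable n : nat.
Implicit Types (f g h : rseries n) (m : seq 'I_n).

Definition rser_one : rseries n :=
  fun m => if uniq m then series1 m else 1.
Definition rser_mul f g : rseries n :=
  fun m => if uniq m then series_mul f g m else f m * g m.

Lemma rser_addA : associative (fun f g : rseries n => fun m => f m + g m).
Proof. by move=> f g h; apply: funext => m; rewrite addrA. Qed.
Lemma rser_addC : commutative (fun f g : rseries n => fun m => f m + g m).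
Proof. by move=> f g; apply: funext => m; rewrite addrC. Qed.
Lemma rser_add0 : left_id (fun=> 0) (fun f g : rseries n => fun m => f m + g m).
Proof. by move=> f; apply: funext => m; rewrite add0r. Qed.
Lemma rser_addN : left_inverse (fun=> 0) (fun f : rseries n => fun m => - f m)
  (fun f g : rseries n => fun m => f m + g m).
Proof. by move=> f; apply: funext => m; rewrite addNr. Qed.

HB.instance Definition _ := gen_eqMixin (rseries n).
HB.instance Definition _ := gen_choiceMixin (rseries n).
HB.instance Definition _ :=
  GRing.isZmodule.Build (rseries n) rser_addA rser_addC rser_add0 rser_addN.

Lemma rser_mulA : associative rser_mul.
Proof.
move=> f g h; apply: funext => m; rewrite /rser_mul.
case: ifP => um; last by rewrite um mulrA.
rewrite (eq_series_mul (f' := f) (g' := series_mul g h)) ?series_mulA//; last first.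
  by move=> k; rewrite drop_uniq.
by apply: eq_series_mul => // k; rewrite take_uniq.
Qed.

Lemma rser_mul1l : left_id rser_one rser_mul.
Proof.
move=> f; apply: funext => m; rewrite /rser_mul /rser_one.
case: ifP => um; last by rewrite ?um mul1r.
rewrite -[RHS]series_mul1l; apply: eq_series_mul => // k.
by rewrite take_uniq.
Qed.

Lemma rser_mul1r : right_id rser_one rser_mul.
Proof.
move=> f; apply: funext => m; rewrite /rser_mul /rser_one.
case: ifP => um; last by rewrite ?um mulr1.
rewrite -[RHS]series_mul1r; apply: eq_series_mul => // k.
by rewrite drop_uniq.
Qed.

Lemma rser_mulDl : left_distributive rser_mul +%R.
Proof.
move=> f g h; apply: funext => m; rewrite /GRing.add/= /rser_mul.
by case: ifP => um; [exact: series_mulDl | rewrite mulrDl].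
Qed.

Lemma rser_mulDr : right_distributive rser_mul +%R.
Proof.
move=> f g h; apply: funext => m; rewrite /GRing.add/= /rser_mul.
by case: ifP => um; [exact: series_mulDr | rewrite mulrDr].
Qed.

HB.instance Definition _ := GRing.Zmodule_isPzRing.Build (rseries n)
  rser_mulA rser_mul1l rser_mul1r rser_mulDl rser_mulDr.

Lemma rserD f g m : (f + g) m = f m + g m. Proof. by []. Qed.
Lemma rserN f m : (- f) m = - f m. Proof. by []. Qed.
Lemma rser0 m : (0 : rseries n) m = 0. Proof. by []. Qed.
Lemma rserM f g m : uniq m -> (f * g) m = series_mul f g m.
Proof. by rewrite {1}/GRing.mul/= /rser_mul => ->. Qed.
Lemma rserM_rep f g m : ~~ uniq m -> (f * g) m = f m * g m.
Proof. by rewrite {1}/GRing.mul/= /rser_mul => /negbTE->. Qed.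
Lemma rser1 m : uniq m -> (1 : rseries n) m = (m == [::])%:R.
Proof. by rewrite {1}/GRing.one/= /rser_one => ->. Qed.

Definition rserX (i : 'I_n) : rseries n := fun m => (m == [:: i])%:R.

(** The two-sided ideal generated by [X_i]; demanding [uniq m] makes its members vanish in the
    auxiliary integer factors. *)
Definition supp (i : 'I_n) f : Prop :=
  forall m, ~~ (uniq m && (i \in m)) -> f m = 0.

Lemma supp_rserX i : supp i (rserX i).
Proof.
move=> m; rewrite /rserX; case: eqP => // ->.
by rewrite mem_seq1 eqxx.
Qed.

Lemma supp_nil i f : supp i f -> f [::] = 0.
Proof. exact. Qed.

Lemma suppM i f g h : supp i f -> supp i (g * f * h).
Proof.
move=> sf; suff sl g' f' : supp i f' -> supp i (g' * f').
  move=> m; case: (boolP (uniq m)) => um /= im; last first.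
    by rewrite !rserM_rep// sf ?(negbTE um)// mulr0 mul0r.
  rewrite rserM//; apply: big1 => k _.
  rewrite (sl g _ sf) ?mul0r// negb_and; apply/orP; right.
  by apply: contra im => /mem_take.
move=> sf' m; case: (boolP (uniq m)) => um /= im; last first.
  by rewrite rserM_rep// sf' ?(negbTE um)// mulr0.
rewrite rserM//; apply: big1 => k _.
rewrite sf' ?mulr0// negb_and; apply/orP; right.
by apply: contra im => /mem_drop.
Qed.

(** A monomial without repetition has [X_i] in at most one of its two parts. Through this fact the
    reduced quotient enters: [1 + f] gets the inverse [1 - f]. *)
Lemma supp_mul0 i f g : supp i f -> supp i g -> f * g = 0.
Proof.
move=> sf sg; apply: funext => m; rewrite rser0.
case: (boolP (uniq m)) => um; last by rewrite rserM_rep// sg ?mulr0// (negbTE um).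
rewrite rserM//; apply: big1 => k _.
case: (boolP (i \in take k m)) => it; last first.
  by rewrite sf ?mul0r// negb_and it orbT.
have : uniq (take k m ++ drop k m) by rewrite cat_take_drop.
rewrite cat_uniq => /and3P[_ /hasPn id _].
rewrite sg ?mulr0// negb_and; apply/orP; right.
by apply/negP => /id; rewrite it.
Qed.

End ReducedSeries.

Section Supp.
Variable n : nat.
Implicit Types (f g h : rseries n) (m : seq 'I_n).

Lemma suppD i f g : supp i f -> supp i g -> supp i (f + g).
Proof. by move=> sf sg m im; rewrite rserD sf// sg// addr0. Qed.

Lemma suppN i f : supp i f -> supp i (- f).
Proof. by move=> sf m im; rewrite rserN sf// oppr0. Qed.

Lemma suppMl i f g : supp i f -> supp i (g * f).
Proof. by move=> sf; rewrite -[g * f]mulr1; apply: suppM. Qed.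

Lemma suppMr i f g : supp i f -> supp i (f * g).
Proof. by move=> sf; rewrite -[f * g]mul1r mulrA; apply: suppM. Qed.

Definition signed (e : bool) f : rseries n := if e then f else - f.

Lemma supp_signed i e f : supp i f -> supp i (signed e f).
Proof. by case: e => //; apply: suppN. Qed.

Lemma signedN e f : signed (~~ e) f = - signed e f.
Proof. by case: e => //=; rewrite opprK. Qed.

Definition agree (k : nat) f g := forall m, (size m <= k)%N -> f m = g m.

(** As [g] has no constant term, a coefficient of degree [k.+1] of the product sees [f] only up to
    degree [k]. This gain of one degree makes the approximations of the arc expansions converge. *)
Lemma agreeMl i k f f' g g' : supp i g -> supp i g' ->
  agree k f f' -> agree k.+1 g g' -> agree k.+1 (f * g) (f' * g').
Proof.
move=> sg sg' ff gg m mk; case: (boolP (uniq m)) => um; last first.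
  by rewrite !rserM_rep// sg ?sg' ?(negbTE um)// !mulr0.
rewrite !rserM//; apply: eq_bigr => l _.
rewrite -gg; last by rewrite size_drop leq_subLR (leq_trans mk)// leq_addl.
have [lm|ml] := ltnP l (size m); last by rewrite drop_oversize// sg// !mulr0.
by rewrite ff// size_take lm -ltnS (leq_trans lm).
Qed.

Lemma agreeMr i k f f' g g' : supp i g -> supp i g' ->
  agree k f f' -> agree k.+1 g g' -> agree k.+1 (g * f) (g' * f').
Proof.
move=> sg sg' ff gg m mk; case: (boolP (uniq m)) => um; last first.
  by rewrite !rserM_rep// sg ?sg' ?(negbTE um)// !mul0r.
rewrite !rserM//; apply: eq_bigr => l _.
rewrite -gg; last by rewrite size_take; case: ifP => // /ltnW/leq_trans; apply.
have [->|l0] := posnP l; first by rewrite take0 sg// !mul0r.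
rewrite ff// size_drop leq_subLR (leq_trans mk)// -addn1 addnC leq_add2r.
exact: l0.
Qed.

End Supp.

Lemma distinct_endsP n N (D : {set arrow n N}) a b (s t : bool) :
  distinct_ends D -> a \in D -> b \in D -> endpt s a = endpt t b ->
  a = b /\ s = t.
Proof.
move=> /forall_inP /(_ a) H aD bD e.
have /forall_inP/(_ b bD)/forallP/(_ s)/forallP/(_ t) := H aD.
by rewrite e eqxx => /andP[/eqP-> /eqP->].
Qed.

(** * Expansions of the arcs, degree by degree *)

Section ArcSeries.
Variables (n : nat) (G : gauss n).
Local Notation arr := (arrow n (gheight G)).

Definition arrow_into (i : 'I_n) (h : nat) : option arr :=
  [pick a in garrows G | ((head a).1 == i) && ((head a).2 == h :> nat)].

(** The signed expansions [C] of the tails are a parameter, which turns the Wirtinger equations into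
    a fixed-point problem. Only heads strictly below [h] are crossed, as in [arc_to]. *)
Fixpoint conj_series (C : arr -> rseries n) (i : 'I_n) (h : nat) : rseries n :=
  if h is h'.+1 then
    if arrow_into i h' is Some a
    then (1 - C a) * conj_series C i h' * (1 + C a) else conj_series C i h'
  else rserX i.

(** Arcs can depend on each other in circles through their tails, so a recursion along the strings
    need not end. Here [k] counts passes that start from zero, each settling one more degree. *)
Fixpoint approx_series (k : nat) (i : 'I_n) (h : nat) : rseries n :=
  if k is k'.+1 then
    conj_series (fun a => signed (gpos a)
      (approx_series k' (tail a).1 (tail a).2)) i h
  else 0.

Lemma supp_conj_series C i h : supp i (conj_series C i h).
Proof.
elim: h => [|h IHh] /=; first exact: supp_rserX.
by case: arrow_into => // a; apply: suppM.
Qed.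

Lemma supp_approx k i h : supp i (approx_series k i h).
Proof. by case: k => [|k] //; apply: supp_conj_series. Qed.

Lemma agree_approx k i h : agree k (approx_series k i h) (approx_series k.+1 i h).
Proof.
elim: k i h => [|k IHk] i h.
  by move=> m; rewrite leqn0 size_eq0 => /eqP->; rewrite [RHS]supp_approx.
set f := approx_series k.+1; rewrite /= {}/f.
elim: h => [|h IHh] //=; case: arrow_into => // a.
apply: (@agreeMr _ i); last apply: (@agreeMl _ i) => //.
- by apply: suppMl; apply: supp_conj_series.
- by apply: suppMl; apply: supp_conj_series.
- move=> m mk; rewrite !rserD; congr (_ + _).
  by case: gpos; rewrite /signed ?rserN IHk.
- exact: supp_conj_series.
- exact: supp_conj_series.
- move=> m mk; rewrite !rserD !rserN; congr (_ - _).
  by case: gpos; rewrite /signed ?rserN IHk.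
Qed.

(* The expansion of the arcs of string [i] is [1 + arc_series i h], where [h] is
   a height on the arc.  Reduced series have degree at most [n], so the
   approximations are stationary from the [n]-th on. *)
Definition arc_series := approx_series n.

Definition tail_series (a : arr) :=
  signed (gpos a) (arc_series (tail a).1 (tail a).2).

Lemma supp_arc_series i h : supp i (arc_series i h).
Proof. exact: supp_approx. Qed.

Lemma supp_tail_series a : supp (tail a).1 (tail_series a).
Proof. by apply: supp_signed; apply: supp_arc_series. Qed.

Lemma arc_seriesE i h : arc_series i h = conj_series tail_series i h.
Proof.
apply: funext => m.
case: (boolP (uniq m)) => um; last first.
  by rewrite supp_arc_series ?supp_conj_series ?(negbTE um).
apply: agree_approx; rewrite -(card_uniqP um).
by have := max_card (mem m); rewrite card_ord.
Qed.

Lemma arc_series0 i : arc_series i 0 = rserX i.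
Proof. by rewrite arc_seriesE. Qed.

Lemma arc_seriesS_some i h a : arrow_into i h = Some a ->
  arc_series i h.+1 =
  (1 - tail_series a) * arc_series i h * (1 + tail_series a).
Proof. by rewrite !arc_seriesE /= => ->. Qed.

Lemma arc_seriesS_none i h : arrow_into i h = None ->
  arc_series i h.+1 = arc_series i h.
Proof. by rewrite !arc_seriesE /= => ->. Qed.

Lemma arrow_intoP a : a \in garrows G ->
  arrow_into (head a).1 (head a).2 = Some a.
Proof.
move=> aG; rewrite /arrow_into; case: pickP => [b|/(_ a)]; last first.
  by rewrite aG !eqxx.
move=> /andP[bG /andP[/eqP e1 /eqP e2]]; congr Some.
have [] := distinct_endsP (gaussP G) bG aG (s := true) (t := true) => //.
by apply/injective_projections => //=; apply/val_inj.
Qed.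

Lemma arrow_into_some i h a : arrow_into i h = Some a ->
  [/\ a \in garrows G, (head a).1 = i & (head a).2 = h :> nat].
Proof.
rewrite /arrow_into; case: pickP => // b /and3P[bG /eqP bi /eqP bh] [<-].
by [].
Qed.

Lemma arrow_into_none i h a : arrow_into i h = None -> a \in garrows G ->
  (head a).1 = i -> (head a).2 <> h :> nat.
Proof. by move=> E /arrow_intoP + ai ah; rewrite ai ah E. Qed.

Lemma arc_series_const i h h' : (h <= h')%N ->
  (forall a, a \in garrows G -> (head a).1 = i -> ~~ (h <= (head a).2 < h')%N) ->
  arc_series i h' = arc_series i h.
Proof.
elim: h' => [|h' IH]; first by rewrite leqn0 => /eqP->.
rewrite leq_eqVlt => /predU1P[->//|]; rewrite ltnS => hh Hno.
case E: (arrow_into i h') => [a|].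
  have [aG ai ah] := arrow_into_some E.
  by have := Hno a aG ai; rewrite ah hh ltnSn.
rewrite arc_seriesS_none// IH// => a aG ai.
apply: contra (Hno a aG ai) => /andP[-> /=]; exact: ltnW.
Qed.

Definition arcD (x : arc G) : rseries n :=
  match x with
  | inl i => rserX i
  | inr a => arc_series (head (val a)).1 (head (val a)).2.+1
  end.

Lemma arcD_arc_to (p : point n (gheight G)) :
  arcD (arc_to p) = arc_series p.1 p.2.
Proof.
rewrite /arc_to; case: pickP => [a /andP[/andP[/eqP pa lt] /forall_inP ap]|Hno] /=.
  rewrite pa; apply/esym; apply: arc_series_const => // b bG bp.
  have := ap b bG; rewrite /below bp eqxx /=.
  case: (ltnP (head b).2 p.2) => //= hb H.
  - by rewrite andbT -leqNgt H.
  - by rewrite andbF.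
rewrite -arc_series0; apply/esym; apply: arc_series_const => // b bG bp.
apply/negP => /= lt.
(* If any head lay below [p], the highest one would have been picked. *)
case: (@arg_maxnP _ b (fun c => (c \in garrows G) && below (head c) p)
  (fun c => (head c).2)); first by rewrite bG /below bp eqxx.
move=> c /andP[cG cp] cmax.
have := Hno (exist _ c cG); rewrite cp /= => /negP; apply.
by apply/forall_inP => d dG; apply/implyP => dp; apply: cmax; rewrite dG.
Qed.

End ArcSeries.

Lemma supp_unit n i (f : rseries n) : supp i f -> (1 + f) * (1 - f) = 1.
Proof.
by move=> sf; rewrite mulrDl mulrBr mulr1 mul1r mulrBr mulr1
  (supp_mul0 sf sf) subr0 subrK.
Qed.

(** * The expansion as an invariant of the reduced tangle group *)

Section Expansion.
Variables (n : nat) (G : gauss n).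

(** [arcD x] squares to zero, so [1 - arcD x] is the expansion of the inverse letter. *)
Definition letter_series (l : arc G * bool) : rseries n :=
  1 + signed l.2 (arcD l.1).

Definition word_series (w : word (arc G)) : rseries n :=
  \prod_(l <- w) letter_series l.

Lemma word_series_cat u v :
  word_series (u ++ v) = word_series u * word_series v.
Proof. by rewrite /word_series big_cat. Qed.

Lemma supp_arcD (x : arc G) : supp (arc_string x) (arcD x).
Proof.
case: x => [i|a]; first exact: supp_rserX.
exact: supp_arc_series.
Qed.

Lemma letter_seriesV (x : arc G) e :
  letter_series (x, e) * letter_series (x, ~~ e) = 1.
Proof.
rewrite /letter_series /= signedN.
exact: (supp_unit (supp_signed e (@supp_arcD x))).
Qed.

Lemma word_seriesVr w : word_series w * word_series (winv w) = 1.
Proof.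
elim: w => [|[x e] w IHw]; first by rewrite /word_series !big_nil mulr1.
rewrite /winv map_cons rev_cons -cats1 -[(x, e) :: w]cat1s !word_series_cat.
rewrite mulrA -(mulrA (word_series [:: _])) IHw mulr1.
by rewrite /word_series !big_seq1 letter_seriesV.
Qed.

Lemma winvK (w : word (arc G)) : winv (winv w) = w.
Proof.
rewrite /winv map_rev revK -map_comp -[RHS]map_id; apply: eq_map => -[x e] /=.
by rewrite negbK.
Qed.

Lemma word_seriesVl w : word_series (winv w) * word_series w = 1.
Proof. by rewrite -{2}(winvK w) word_seriesVr. Qed.

(** A meridian and its conjugate expand to [1 + f] with [f] in the ideal of [X_i]. Such series are
    multiplied by adding their [f], so every commutator of them is 1. *)
Lemma word_series_comm (i : 'I_n) (w : word (arc G)) :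
  let m := [:: (meridian G i, true)] in
  word_series (wcomm m (winv w ++ m ++ w)) = 1.
Proof.
move=> m; set y := winv w ++ m ++ w.
have Em : word_series m = 1 + rserX i.
  by rewrite /word_series big_seq1.
pose Y := word_series (winv w) * rserX i * word_series w.
have Ey : word_series y = 1 + Y.
  by rewrite !word_series_cat Em mulrA mulrDr mulrDl mulr1 word_seriesVl.
clearbody y.
have sX := @supp_rserX n i; have sY : supp i Y by apply: suppM.
have inv f u : supp i f -> word_series u = 1 + f -> word_series (winv u) = 1 - f.
  move=> sf Eu; rewrite -[LHS]mulr1 -[X in _ * X = _](supp_unit sf) -Eu.
  by rewrite mulrA word_seriesVl mul1r.
rewrite !word_series_cat (inv _ _ sX Em) (inv _ _ sY Ey) Em Ey mulrA.
have prodE f g : supp i f -> supp i g -> (1 + f) * (1 + g) = 1 + (f + g).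
  move=> sf sg; rewrite mulrDl mul1r mulrDr mulr1 (supp_mul0 sf sg) addr0.
  by rewrite -addrA [g + f]addrC.
have [sX' sY'] := (suppN sX, suppN sY).
have [sXY sXY'] := (suppD sX sY, suppD sX' sY').
rewrite prodE// prodE// prodE//.
by rewrite -opprD addNr addr0.
Qed.

Lemma word_series_wirtinger u v :
  @wirtinger n G u v -> word_series u = word_series v.
Proof.
case=> a over eps; rewrite /word_series big_seq1 !big_cons big_nil mulr1.
rewrite /letter_series /= signedN arcD_arc_to.
have -> : signed eps (arcD over) = tail_series (val a).
  by rewrite arcD_arc_to.
have sa := @supp_tail_series n G (val a).
rewrite (arc_seriesS_some (arrow_intoP (valP a))).
set t := tail_series _ in sa *; set f := arc_series _ _ _.
rewrite [(1 + f) * _]mulrDl mul1r mulrDr mulrA; congr (_ + _).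
by have := supp_unit (suppN sa); rewrite opprK => ->.
Qed.

Lemma word_seriesP u v : pres_eq (@reduced n G) u v ->
  word_series u = word_series v.
Proof.
elim=> {u v} [u v|x e|u u' v v' _ Eu _ Ev|u|u v _ ->|u v w _ -> _ ->] //.
- case=> [{}u {}v|i w m]; first exact: word_series_wirtinger.
  by rewrite [LHS](word_series_comm i w) /word_series big_nil.
- by rewrite /word_series big_cons big_seq1 letter_seriesV big_nil.
- by rewrite !word_series_cat Eu Ev.
Qed.

(** All terms of degree at least two in the expansion of an inverse letter repeat that letter, so at
    these monomials the geometric series agrees with [1 - X_i]. *)
Lemma magnus_word_series (w : word 'I_n) (m : seq 'I_n) : uniq m ->
  magnus w m = word_series (wmap (meridian G) w) m.
Proof.
elim: w m => [|[i e] w IHw] m um.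
  by rewrite /word_series big_nil rser1.
rewrite /word_series /= big_cons rserM//.
apply: eq_series_mul => k; last by rewrite IHw ?drop_uniq.
have : uniq (take k m) by rewrite take_uniq.
move: (take k m) => {um}m um.
rewrite /letter_series rserD rser1// /magnus_letter.
case: e => //=; rewrite rserN /rserX.
case: m um => [|x [|y m]] //= um; first by rewrite eqseq_cons !andbT expr1 mulrN1 add0r.
rewrite add0r !eqseq_cons andbF oppr0; case: eqP => [xi|_]; last by rewrite mul0r.
case: eqP => [yi|_]; last by rewrite mul0r.
by move: um; rewrite xi yi inE eqxx.
Qed.

End Expansion.

(** * The expansion of the parallel *)

Section Parallel.
Variables (n : nat) (G : gauss n).

Lemma word_series_pow (f : rseries n) (j : 'I_n) e k m :
  uniq m -> j \notin m ->
  (f * word_series (nseq k (meridian G j, e))) m = f m.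
Proof.
move=> um jm; elim: k => [|k IHk]; first by rewrite /word_series big_nil mulr1.
rewrite -IHk -addn1 nseqD word_series_cat {2}/word_series big_seq1.
rewrite /letter_series mulrDr mulr1 mulrDr rserD [X in _ + X](_ : _ = 0) ?addr0//.
rewrite mulrA; apply: (@suppMl n j); last by rewrite negb_and jm orbT.
by apply: supp_signed; apply: supp_rserX.
Qed.

(** The initial segment of the parallel without its correcting power; the truncation at [h] permits
    induction along the string. *)
Definition longitude (j : 'I_n) (h : nat) : rseries n :=
  \prod_(a <- heads_on G j | ((head a).2 < h)%N) (1 + tail_series a).

Lemma heads_on_sorted j :
  sorted (fun a b => ((head a).2 <= (head b).2)%N) (heads_on G j).
Proof. by apply: sort_sorted => a b; apply: leq_total. Qed.

Lemma heads_on_uniq j : uniq (heads_on G j).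
Proof. by rewrite sort_uniq filter_uniq// enum_uniq. Qed.

Lemma mem_heads_on j a :
  (a \in heads_on G j) = (a \in garrows G) && ((head a).1 == j).
Proof. by rewrite mem_sort mem_filter mem_enum andbC. Qed.

Lemma filter_sortedS (T : Type) (ht : T -> nat) (s : seq T) (h : nat) :
  sorted (fun a b => ht a <= ht b)%N s ->
  [seq a <- s | (ht a < h.+1)%N] =
  [seq a <- s | (ht a < h)%N] ++ [seq a <- s | ht a == h].
Proof.
elim: s => //= x s IHs xs; have ss := path_sorted xs.
rewrite IHs// ltnS; have [lt|gt|eq] := ltngtP (ht x) h => //=.
rewrite (_ : [seq a <- s | (ht a < h)%N] = [::])//.
apply: size0nil; apply/eqP.
rewrite size_filter -leqn0 leqNgt -has_count -all_predC.
have := order_path_min (fun a b c => @leq_trans (ht a) (ht b) (ht c)) xs.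
by apply: sub_all => y /=; rewrite -leqNgt eq.
Qed.

Lemma longitudeS j h :
  longitude j h.+1 = longitude j h *
    (if arrow_into G j h is Some a then 1 + tail_series a else 1).
Proof.
rewrite /longitude -big_filter filter_sortedS ?heads_on_sorted//.
rewrite big_cat big_filter; congr (_ * _).
case E: arrow_into => [a|]; last first.
  rewrite big_filter big_seq_cond big1// => a; rewrite mem_heads_on.
  by move=> /andP[/andP[aG /eqP ai] /eqP /(arrow_into_none E aG)]; case.
have [aG ai ah] := arrow_into_some E.
rewrite (@eq_in_filter _ _ (pred1 a)) ?filter_pred1_uniq ?heads_on_uniq ?big_seq1//.
  by rewrite mem_heads_on aG ai eqxx.
move=> b; rewrite mem_heads_on => /andP[bG /eqP bi] /=.
apply/eqP/eqP => [bh|->//].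
by have := arrow_intoP bG; rewrite bi bh E => -[].
Qed.

(* A monomial that starts with the letter of the trunk only sees the right half
   of the conjugate [Lambda^-1 X_j Lambda]. *)
Lemma arc_series_longitude j h s : uniq (j :: s) ->
  arc_series G j h (j :: s) = longitude j h s.
Proof.
elim: h s => [|h IHh] s us.
  rewrite arc_series0 /longitude big_pred0// rser1; last by case/andP: us.
  by rewrite /rserX eqseq_cons eqxx.
have [js us'] := andP us.
rewrite longitudeS; case E: arrow_into => [a|]; last first.
  by rewrite (arc_seriesS_none E) IHh// mulr1.
rewrite (arc_seriesS_some E) -mulrA mulrBl mul1r rserD rserN.
have sD : supp j (arc_series G j h * (1 + tail_series a)).
  by apply: suppMr; apply: supp_arc_series.
(* The factor [tail_series a] has no constant term and so absorbs the leading letter [j]; the other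
   factor lies in the ideal of [X_j] and vanishes on what remains of [s]. *)
rewrite [X in _ - X](_ : _ = 0) ?subr0; last first.
  rewrite rserM// series_mul_cons (supp_nil (@supp_tail_series _ _ _)) mul0r add0r.
  apply: big1 => k _; rewrite sD ?mulr0// negb_and; apply/orP; right.
  by apply: contra js => /mem_drop.
rewrite !rserM// series_mul_cons (supp_nil (@supp_arc_series _ _ _ _)) mul0r add0r.
apply: eq_bigr => k _; rewrite IHh//= take_uniq// andbT.
by apply: contra js => /mem_take.
Qed.

Lemma word_series_parallel j s : uniq (j :: s) ->
  word_series (parallel G j) s = arc_series G j (gheight G) (j :: s).
Proof.
move=> us; have [js us'] := andP us.
rewrite arc_series_longitude// /parallel word_series_cat word_series_pow//.
rewrite /longitude /word_series big_map; congr (_ s).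
apply: eq_big => [a|a _]; first by rewrite ltn_ord.
by rewrite /letter_series /= arcD_arc_to.
Qed.

End Parallel.

(** * Conjugation in a presented group *)

Section WordConj.
Variable X : Type.
Implicit Types u v w : word X.

Lemma winv_cat u v : winv (u ++ v) = winv v ++ winv u.
Proof. by rewrite /winv map_cat rev_cat. Qed.

Lemma wmap_winv Y (f : X -> Y) w : wmap f (winv w) = winv (wmap f w).
Proof. by rewrite /wmap /winv map_rev -!map_comp. Qed.

Definition wconj u w : word X := winv w ++ u ++ w.

Lemma wconj_cat u w v : wconj u (w ++ v) = winv v ++ wconj u w ++ v.
Proof. by rewrite /wconj winv_cat !catA. Qed.

Variable R : word X -> word X -> Prop.
Local Notation "u ~ v" := (pres_eq R u v) (at level 70).

Lemma pres_congr v u u' w : u ~ u' -> v ++ u ++ w ~ v ++ u' ++ w.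
Proof.
move=> uu; apply: pres_cat; first exact: pres_refl.
by apply: pres_cat => //; apply: pres_refl.
Qed.

Lemma pres_winvr w : w ++ winv w ~ [::].
Proof.
elim: w => [|[x e] w IHw]; first exact: pres_refl.
rewrite -cat1s winv_cat -catA [w ++ _]catA.
apply: (pres_trans (pres_congr _ _ IHw)); exact: pres_cancel.
Qed.

Lemma pres_winvl w : winv w ++ w ~ [::].
Proof.
elim/last_ind: w => [|w [x e] IHw]; first exact: pres_refl.
rewrite -cats1 winv_cat -catA [winv w ++ _]catA.
apply: (pres_trans (pres_congr _ _ IHw)).
by have := pres_cancel R x (~~ e); rewrite negbK.
Qed.

Lemma pres_winv u v : u ~ v -> winv u ~ winv v.
Proof.
move=> uv.
have E1 : winv u ++ v ++ winv v ~ winv u.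
  rewrite -[X in _ ~ X]cats0; apply: pres_cat; first exact: pres_refl.
  exact: pres_winvr.
apply: (pres_trans (pres_sym E1)); rewrite catA.
rewrite -[X in _ ~ X]cat0s; apply: pres_cat; last exact: pres_refl.
apply: pres_trans (pres_winvl u); apply: pres_cat; first exact: pres_refl.
exact: pres_sym.
Qed.

Lemma pres_wconj u u' w w' : u ~ u' -> w ~ w' -> wconj u w ~ wconj u' w'.
Proof.
move=> uu ww; apply: pres_cat; first exact: pres_winv.
exact: pres_cat.
Qed.

Lemma pres_comm u v : wcomm u v ~ [::] -> wconj v u ~ v.
Proof.
rewrite /wcomm /wconj => uv.
have vu : u ++ v ~ v ++ u.
  apply: pres_trans (_ : (v ++ u) ++ winv u ++ winv v ++ u ++ v ~ _); last first.
    by rewrite -[X in _ ~ X]cats0; apply: pres_cat => //; apply: pres_refl.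
  have -> : (v ++ u) ++ winv u ++ winv v ++ u ++ v =
      ((v ++ u) ++ winv u ++ winv v) ++ (u ++ v) by rewrite !catA.
  rewrite -[X in X ~ _]cat0s; apply: pres_cat; last exact: pres_refl.
  apply: pres_sym; rewrite -!catA (catA u).
  exact: (pres_trans (pres_congr v (winv v) (pres_winvr u)) (pres_winvr v)).
apply: (pres_trans (pres_cat (pres_refl R _) (pres_sym vu))).
rewrite catA -[X in _ ~ X]cat0s; apply: pres_cat; last exact: pres_refl.
exact: pres_winvl.
Qed.

End WordConj.

Lemma pres_eq_sub X (R R' : word X -> word X -> Prop) u v :
  (forall u v, R u v -> R' u v) -> pres_eq R u v -> pres_eq R' u v.
Proof.
move=> RR'; elim=> {u v} [u v /RR'|x e|u u' v v' _ + _|u|u v _|u v w _ + _].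
- exact: pres_rel.
- exact: pres_cancel.
- exact: pres_cat.
- exact: pres_refl.
- exact: pres_sym.
- exact: pres_trans.
Qed.

(** * The meridians generate the reduced group *)

Section Generation.
Variables (n : nat) (G : gauss n).
Local Notation m_ i := ([:: (meridian G i, true)] : word (arc G)).

(* The quotient of the reduced tangle group by the meridians of the strings in
   [S]. *)
Inductive reduced_off (S : {set 'I_n}) : word (arc G) -> word (arc G) -> Prop :=
| reduced_off_red u v : reduced u v -> reduced_off S u v
| reduced_off_kill i : i \in S -> reduced_off S (m_ i) [::].

(* The conjugates of [m_ i] commute, so that the normal closure of [m_ i] acts
   trivially on them. *)
Lemma wconj_meridian_kill S i u v : pres_eq (reduced_off (i |: S)) u v ->
  forall w, pres_eq (reduced_off S) (wconj (m_ i) (w ++ u)) (wconj (m_ i) (w ++ v)).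
Proof.
elim=> {u v} [u v Ruv|x e|u u' v v' _ IHu _ IHv|u|u v _ IH|u v v' _ IH1 _ IH2] w.
- case: Ruv => [{}u {}v uv|k].
    apply: pres_wconj; first exact: pres_refl.
    by apply: pres_cat; [exact: pres_refl|apply/pres_rel/reduced_off_red].
  rewrite in_setU1 => /predU1P[->|kS].
    rewrite cats0 wconj_cat; apply: (@pres_comm _ _ (m_ i) (wconj (m_ i) w)).
    by apply/pres_rel/reduced_off_red; apply: reduced_comm.
  apply: pres_wconj; first exact: pres_refl.
  by apply: pres_cat; [exact: pres_refl|apply/pres_rel/reduced_off_kill].
- apply: pres_wconj; first exact: pres_refl.
  by apply: pres_cat; [exact: pres_refl|exact: pres_cancel].
(* First [u] is replaced with [v] pulled out as an outer conjugator, then [u'] joins the prefix;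
   hence the arbitrary prefix [w]. *)
- rewrite !catA; apply: pres_trans (IHv (w ++ u')).
  by rewrite !(wconj_cat _ (w ++ _)); apply: pres_congr; apply: IHu.
- exact: pres_refl.
- exact: pres_sym (IH w).
- exact: pres_trans (IH1 w) (IH2 w).
Qed.

(** Follow the string back to its start: each arrowhead crossed adds its over-passing arc to the
    conjugator. *)
Lemma arc_conj_meridian (x : arc G) :
  exists i w, pres_eq (@reduced n G) [:: (x, true)] (wconj (m_ i) w).
Proof.
case: x => [i|a]; first by exists i, [::]; apply: pres_refl.
elim: {a}_.+1 {-2}a (ltnSn (head (val a)).2) => // k IHk a ak.
pose o : word (arc G) := [:: (arc_to (tail (val a)), gpos (val a))].
have Ha : pres_eq (@reduced n G) [:: (inr a, true)]
    (wconj [:: (arc_to (head (val a)), true)] o).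
  by apply/pres_rel/reduced_wirtinger/Wirtinger.
suff [i [w Hw]] : exists i w, pres_eq (@reduced n G)
    [:: (arc_to (head (val a)), true)] (wconj (m_ i) w).
  exists i, (w ++ o); rewrite wconj_cat; apply: (pres_trans Ha).
  by apply: (@pres_wconj _ _ _ (wconj (m_ i) w) o o) => //; apply: pres_refl.
rewrite /arc_to; case: pickP => [b /andP[/andP[_ lt] _]|_].
  by apply: IHk; rewrite (leq_trans lt).
by eexists _, [::]; apply: pres_refl.
Qed.

(** Induction on the number of strings outside [S]. An arc is a conjugate of some meridian [m_ i],
    hence trivial if [i] is in [S]. Otherwise the induction hypothesis writes the conjugator in
    meridians after killing [m_ i] as well, and by [wconj_meridian_kill] this coarser congruence
    leaves the conjugate unchanged. *)
Lemma meridians_generate_off (S : {set 'I_n}) (u : word (arc G)) :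
  exists w : word 'I_n, pres_eq (reduced_off S) (wmap (meridian G) w) u.
Proof.
elim: {S}_.+1 {-2}S (ltnSn #|~: S|) u => // k IHk S Sk u.
have gen x : exists w : word 'I_n,
    pres_eq (reduced_off S) (wmap (meridian G) w) [:: (x, true)].
  have [i [w xw]] := arc_conj_meridian x.
  have {}xw : pres_eq (reduced_off S) [:: (x, true)] (wconj (m_ i) w).
    by apply: pres_eq_sub xw => ? ?; apply: reduced_off_red.
  have [iS|iS] := boolP (i \in S).
    exists [::]; apply: pres_sym; apply: (pres_trans xw).
    apply: pres_trans (pres_winvl _ w).
    exact: (pres_congr (winv w) w (pres_rel (reduced_off_kill iS))).
  have [|h Hh] := IHk (i |: S) _ w.
    rewrite -ltnS (leq_trans _ Sk)// ltnS setCU proper_card//.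
    apply/properP; split; first exact: subsetIr.
    by exists i; rewrite ?inE ?iS// eqxx.
  exists (wconj [:: (i, true)] h).
  have -> : wmap (meridian G) (wconj [:: (i, true)] h) =
            wconj (m_ i) (wmap (meridian G) h).
    by rewrite /wconj -wmap_winv /wmap !map_cat.
  apply: pres_trans (pres_sym xw).
  exact: (wconj_meridian_kill Hh [::]).
elim: u => [|[x e] u [w Hw]]; first by exists [::]; apply: pres_refl.
have [h Hh] := gen x.
have [h' Hh'] : exists h', pres_eq (reduced_off S) (wmap (meridian G) h') [:: (x, e)].
  case: e; first by exists h.
  by exists (winv h); rewrite wmap_winv; apply: pres_winv Hh.
by exists (h' ++ w); rewrite /wmap map_cat -cat1s; apply: pres_cat.
Qed.

Lemma in_meridiansP (u : word (arc G)) :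
  pres_eq (@reduced n G) (wmap (meridian G) (in_meridians u)) u.
Proof.
apply: (@classical_sets.xgetPex _ [::]
  (fun w => pres_eq (@reduced n G) (wmap (meridian G) w) u)).
have [w Hw] := meridians_generate_off set0 u; exists w.
by apply: pres_eq_sub Hw => u' v' []// i; rewrite in_set0.
Qed.

Lemma mu_arc_series (j : 'I_n) (s : seq 'I_n) : uniq (j :: s) ->
  mu s j G = arc_series G j (gheight G) (j :: s).
Proof.
move=> us; have us' : uniq s by case/andP: us.
rewrite /mu /theta /modulo_repeats us' (magnus_word_series G)//.
by rewrite (word_seriesP (in_meridiansP _)) word_series_parallel.
Qed.

End Generation.

(** * Leaf sequences, grafting and cutting of planar trees *)

Section LeafOrder.
Variables (n N : nat).
Implicit Types (T : {set arrow n N}) (i : 'I_n) (k : nat) (u v m : seq 'I_n).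

Lemma leaf_order_inv T i k w : leaf_order T i k w ->
  ((forall a, a \in T -> ~ ((head a).1 = i /\ ((head a).2 < k)%N)) /\ w = [:: i])
  \/ exists a u v,
    [/\ [/\ a \in T, (head a).1 = i & ((head a).2 < k)%N],
        forall b, b \in T -> (head b).1 = i -> ((head b).2 < k)%N ->
          ((head b).2 <= (head a).2)%N,
        leaf_order T i (head a).2 u, leaf_order T (tail a).1 (tail a).2 v
      & w = u ++ v \/ w = v ++ u].
Proof. by case=> [{}i {}k H|a {}k u v {}w *]; [left|right; exists a, u, v]. Qed.

Lemma perm_fork u v w : w = u ++ v \/ w = v ++ u -> perm_eq w (u ++ v).
Proof. by case=> ->; rewrite // perm_catC. Qed.

Lemma mem_fork u v w : w = u ++ v \/ w = v ++ u ->
  forall x, (x \in w) = (x \in u) || (x \in v).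
Proof. by move=> /perm_fork/perm_mem e x; rewrite e mem_cat. Qed.

Lemma uniq_fork u v w : w = u ++ v \/ w = v ++ u -> uniq w ->
  [/\ uniq u, uniq v & forall x, x \in u -> x \in v -> False].
Proof.
move=> /perm_fork/perm_uniq -> ; rewrite cat_uniq => /and3P[uu /hasPn H vv].
by split=> // x xu /H; rewrite /= xu.
Qed.

Lemma leaf_order_root T i k u : leaf_order T i k u -> i \in u.
Proof.
elim=> [{}i {}k _|a {}k u' v w aT _ _ _ IHu _ _ /mem_fork ->].
  by rewrite mem_seq1.
by rewrite IHu.
Qed.

Lemma leaf_order0 T i m : leaf_order T i 0 m <-> m = [:: i].
Proof.
split=> [/leaf_order_inv[[]//|[a [u [v [[]]]]]]//|->].
by apply: LeafStart => a _ [].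
Qed.

Lemma leaf_orderS_none T i k m :
  (forall a, a \in T -> (head a).1 = i -> (head a).2 <> k :> nat) ->
  leaf_order T i k.+1 m <-> leaf_order T i k m.
Proof.
move=> Hno.
have lt a : a \in T -> (head a).1 = i -> ((head a).2 < k.+1)%N = ((head a).2 < k)%N.
  by move=> aT ai; rewrite ltnS leq_eqVlt; case: eqP => // /(Hno a aT ai).
split=> /leaf_order_inv[[H ->]|[a [u [v [[aT ai ak] H lu lv w]]]]].
- by apply: LeafStart => a aT [ai]; rewrite -lt// => ak; apply: (H a).
- rewrite -ai; apply: (LeafFork (u := u) (v := v)) => //; rewrite ?ai//.
    by rewrite -lt.
  by move=> b bT bi; rewrite -lt//; apply: H.
- by apply: LeafStart => a aT [ai]; rewrite lt// => ak; apply: (H a).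
- rewrite -ai; apply: (LeafFork (u := u) (v := v)) => //; rewrite ?ai//.
    by rewrite lt.
  by move=> b bT bi; rewrite lt//; apply: H.
Qed.

Lemma head_inj T a b : distinct_ends T -> a \in T -> b \in T ->
  (head a).1 = (head b).1 -> (head a).2 = (head b).2 :> nat -> a = b.
Proof.
move=> dT aT bT e1 e2.
have [] := distinct_endsP dT aT bT (s := true) (t := true) => //.
by apply/injective_projections => //=; apply/val_inj.
Qed.

Lemma leaf_orderS_some T i k m a : distinct_ends T -> a \in T ->
  (head a).1 = i -> (head a).2 = k :> nat ->
  leaf_order T i k.+1 m <->
  exists u v, [/\ leaf_order T i k u, leaf_order T (tail a).1 (tail a).2 v
                & m = u ++ v \/ m = v ++ u].
Proof.
move=> dT aT ai ak; split; last first.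
  case=> u [v [lu lv w]]; rewrite -ai.
  apply: (LeafFork (u := u) (v := v)) => //; rewrite ?ai ?ak//.
move=> /leaf_order_inv[[H _]|[b [u [v [[bT bi bk] H lu lv w]]]]].
  by case: (H a aT); rewrite ak ltnSn.
have ab : a = b.
  apply: (head_inj dT) => //; first by rewrite ai bi.
  by apply/eqP; rewrite eqn_leq H// ?ak// -ltnS.
by subst b; exists u, v; rewrite -{1}ak.
Qed.

(** A drawing only chooses sides at the forks, so the set of leaves is fixed by the arrows. This
    later recovers a cut from the tree. *)
Lemma leaf_order_mem T i k u u' : distinct_ends T ->
  leaf_order T i k u -> leaf_order T i k u' -> u =i u'.
Proof.
move=> dT lu; elim: lu u' => {i k u} [i k H|a k u v w aT ak H lu IHu lv IHv w_uv] u'.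
  by move=> /leaf_order_inv[[_ ->]//|[a [? [? [[aT ai ak]]]]]]; case: (H a aT).
move=> /leaf_order_inv[[H' _]|[b [u2 [v2 [[bT bi bk] H' lu2 lv2 w_uv2]]]]].
  by case: (H' a aT).
have ab : a = b.
  apply: (head_inj dT) => //.
  by apply/eqP; rewrite eqn_leq H'// H.
subst b => x.
by rewrite (mem_fork w_uv) (mem_fork w_uv2) (IHu _ lu2) (IHv _ lv2).
Qed.

(** Reading the leaves consults only heads on strings of [u], and on the root string only those
    below [k]. As [u] has no repetition, trunk and branch occupy disjoint strings, and each can be
    read in its own set of arrows. *)
Lemma leaf_order_agree T T' i k u : uniq u -> leaf_order T i k u ->
  (forall b, (head b).1 \in u -> ((head b).1 = i -> ((head b).2 < k)%N) ->
     (b \in T) = (b \in T')) ->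
  leaf_order T' i k u.
Proof.
move=> uu lu; elim: lu uu => {i k u} [i k H|a k u v w aT ak H lu IHu lv IHv w_uv] uu TT.
  apply: LeafStart => b bT' [bi bk]; apply: (H b) => //.
  by rewrite TT// bi mem_seq1.
have [Uu Uv Uuv] := uniq_fork w_uv uu; have ru := leaf_order_root lu.
apply: (LeafFork (u := u) (v := v)) => //.
- by rewrite -TT// (mem_fork w_uv) ru.
- move=> b bT' ba bk; apply: H => //; rewrite TT// (mem_fork w_uv) ba ru//.
- apply: IHu => // b bu bk; apply: TT; first by rewrite (mem_fork w_uv) bu.
  by move=> /bk /ltn_trans; apply.
- apply: IHv => // b bv bk; apply: TT; first by rewrite (mem_fork w_uv) bv orbT.
  by move=> ba; case: (Uuv (head a).1) => //; rewrite -ba.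
Qed.

(** As tails are injective, an arrow whose tail is on a leaf other than the root is the one that
    attached this leaf to the tree. The arrow [c] leaves the string of its head; that it does so
    further up is the condition that arrowheads precede the arrowtail. *)
Lemma leaf_order_head T i k u : uniq u -> leaf_order T i k u ->
  {in T &, injective (fun a => (tail a).1)} ->
  forall b, b \in T -> (tail b).1 \in u -> (tail b).1 <> i ->
  [/\ (head b).1 \in u, (tail b).1 != (head b).1,
      (head b).1 = i -> ((head b).2 < k)%N
    & (head b).1 <> i -> exists2 c, c \in T &
        (tail c).1 = (head b).1 /\ ((head b).2 < (tail c).2)%N].
Proof.
move=> uu lu injT; elim: lu uu => {i k u}
  [i k H|a k u v w aT ak H lu IHu lv IHv w_uv] uu b bT.
  by rewrite mem_seq1 => /eqP.
have [Uu Uv Uuv] := uniq_fork w_uv uu; have ru := leaf_order_root lu.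
have rv := leaf_order_root lv; rewrite !(mem_fork w_uv) => /orP[bu|bv] bi.
  have [h1 h2 h3 h4] := IHu Uu b bT bu bi.
  by split=> //; [rewrite h1 | move=> /h3 /ltn_trans; apply].
have [ba|ba] := eqVneq (tail b).1 (tail a).1.
  have -> : b = a by apply: injT.
  split=> //; first by rewrite ru.
  by apply: contraTneq rv => ->; apply/negP => /(Uuv _ ru).
have [h1 h2 h3 h4] := IHv Uv b bT bv (elimN eqP ba).
split=> //; first by rewrite h1 orbT.
- by move=> hi; case: (Uuv _ ru); rewrite -hi.
- move=> _; have [ha|ha] := eqVneq (head b).1 (tail a).1; last exact/h4/eqP.
  by exists a => //; split=> //; apply: h3.
Qed.

(* [T] is the set of all arrows of a planar tree flowing into the point of
   height [k] of string [i], with leaves [m]. *)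
Definition tree_into T i k m : Prop :=
  [/\ uniq m,
      forall a, a \in T -> (tail a).1 \in m /\ (tail a).1 <> i,
      forall p, p \in m -> p <> i -> exists2 a, a \in T & (tail a).1 = p,
      {in T &, injective (fun a => (tail a).1)}
    & leaf_order T i k m].

Lemma tree_into_root T i k m : tree_into T i k m -> i \in m.
Proof. by case=> _ _ _ _ /leaf_order_root. Qed.

Lemma tree_into_head T i k m b : tree_into T i k m -> b \in T ->
  [/\ (head b).1 \in m, (tail b).1 != (head b).1,
      (head b).1 = i -> ((head b).2 < k)%N
    & (head b).1 <> i -> exists2 c, c \in T &
        (tail c).1 = (head b).1 /\ ((head b).2 < (tail c).2)%N].
Proof.
by case=> um tl _ inj lm bT; have [bm bi] := tl b bT; apply: leaf_order_head.
Qed.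

Lemma tree_into0 T i m : tree_into T i 0 m <-> T = set0 /\ m = [:: i].
Proof.
split=> [[um tl _ _ /leaf_order0 mi]|[-> ->]].
  split=> //; apply/setP => b; rewrite in_set0; apply/negP => /tl.
  by rewrite mi mem_seq1 => -[/eqP].
split=> //; try by move=> a; rewrite in_set0.
- by move=> p; rewrite mem_seq1 => /eqP.
- exact/leaf_order0.
Qed.

Lemma tree_intoS T i k m :
  (forall a, a \in T -> (head a).1 = i -> (head a).2 <> k :> nat) ->
  tree_into T i k.+1 m <-> tree_into T i k m.
Proof.
by move=> Hno; split=> -[*]; split=> //; apply/(leaf_orderS_none _ Hno).
Qed.

Lemma tree_into_no_head T i k m : tree_into T i k m ->
  forall a, a \in T -> (head a).1 = i -> (head a).2 <> k :> nat.
Proof.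
move=> tT a /(tree_into_head tT)[_ _ H _] /H + ak.
by rewrite ak ltnn.
Qed.

Section Fork.
Variables (a : arrow n N) (i : 'I_n) (k : nat).
Hypotheses (ai : (head a).1 = i) (ak : (head a).2 = k :> nat).
Let i' := (tail a).1.
Let k' : nat := (tail a).2.

(** The final equations recover both pieces from the union and the leaves, which makes grafting
    injective. The tail of [a] lies on [i'], itself a leaf of [v], hence the exclusion of [i'] in
    the equation for [T2]. *)
Lemma tree_into_join (T1 T2 : {set arrow n N}) u v m :
  let T := a |: (T1 :|: T2) in distinct_ends T -> uniq m ->
  m = u ++ v \/ m = v ++ u -> tree_into T1 i k u -> tree_into T2 i' k' v ->
  [/\ tree_into T i k.+1 m, leaf_order T i k u, a \notin T1 :|: T2,
      [disjoint T1 & T2]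
    & T1 = [set b in T | (tail b).1 \in u] /\
      T2 = [set b in T | ((tail b).1 \in v) && ((tail b).1 != i')]].
Proof.
move=> T dT um muv t1 t2; have [Uu Uv Uuv] := uniq_fork muv um.
have [_ tl1 ex1 inj1 l1] := t1; have [_ tl2 ex2 inj2 l2] := t2.
have ru := tree_into_root t1; have rv := tree_into_root t2.
have hd1 := tree_into_head t1; have hd2 := tree_into_head t2.
have memT b : b \in T = [|| b == a, b \in T1 | b \in T2] by rewrite !inE.
have aT1 : a \notin T1.
  by apply/negP => /tl1[au _]; apply: (Uuv _ au rv).
have aT2 : a \notin T2 by apply/negP => /tl2[].
have t12 b : b \in T1 -> b \in T2 -> False.
  by move=> /tl1[bu _] /tl2[bv _]; apply: (Uuv _ bu bv).
have lu : leaf_order T i k u.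
  apply: (leaf_order_agree Uu l1) => b bu bi; rewrite memT.
  have [e|_] := eqVneq b a; first by move: bi; rewrite e ai ak ltnn => /(_ erefl).
  rewrite /= orbC; case: (boolP (b \in T2)) => // /hd2[bv _ _ _].
  by case: (Uuv _ bu bv).
have lv : leaf_order T i' k' v.
  apply: (leaf_order_agree Uv l2) => b bv bi; rewrite memT.
  have [e|_] := eqVneq b a; first by case: (Uuv _ ru); rewrite -ai -e.
  rewrite /=; case: (boolP (b \in T1)) => // /hd1[bu _ _ _].
  by case: (Uuv _ bu bv).
split=> //.
- split=> //.
  + move=> b; rewrite memT !(mem_fork muv) => /or3P[/eqP->|/tl1[-> ?]|/tl2[bv _]] //.
      by rewrite rv orbT; split=> // e; apply: (Uuv _ ru); rewrite -e.
    by rewrite bv orbT; split=> // e; apply: (Uuv _ ru); rewrite -e.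
  + move=> p; rewrite (mem_fork muv) => /orP[pu /(ex1 _ pu)|pv _].
      by case=> b bT1 <-; exists b; rewrite // memT bT1 orbT.
    have [pi|pi] := eqVneq p i'; first by exists a; rewrite // memT eqxx.
    have [b bT2 <-] := ex2 p pv (elimN eqP pi).
    by exists b; rewrite // memT bT2 !orbT.
  + move=> b c; rewrite !memT => /or3P[/eqP->|b1|b2] /or3P[/eqP->|c1|c2] // e.
    * by case: (Uuv (tail a).1) => //; rewrite e; case: (tl1 c c1).
    * by case: (tl2 c c2) => _; rewrite -e.
    * by case: (Uuv (tail a).1) => //; rewrite -e; case: (tl1 b b1).
    * exact: inj1.
    * by case: (Uuv (tail b).1); [case: (tl1 b b1)|rewrite e; case: (tl2 c c2)].
    * by case: (tl2 b b2) => _; rewrite e.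
    * by case: (Uuv (tail b).1); [rewrite e; case: (tl1 c c1)|case: (tl2 b b2)].
    * exact: inj2.
  + apply/(leaf_orderS_some _ dT _ ai ak); first by rewrite memT eqxx.
    by exists u, v.
- by rewrite inE negb_or aT1.
- by rewrite -setI_eq0; apply/eqP/setP => b; rewrite !inE; apply/negP => /andP[/t12].
- split; apply/setP => b; rewrite in_set memT.
    apply/idP/andP => [b1|[/or3P[/eqP->|//|b2] bu]].
    + by rewrite b1 orbT; case: (tl1 b b1).
    + by case: (Uuv _ bu rv).
    + by case: (Uuv _ bu); case: (tl2 b b2).
  apply/idP/and3P => [b2|[/or3P[/eqP->|b1|//] bv]].
  + by rewrite b2 !orbT; have [-> /eqP ->] := tl2 b b2.
  + by rewrite eqxx.
  + by case: (Uuv (tail b).1) => //; case: (tl1 b b1).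
Qed.

Lemma tree_into_split T m : distinct_ends T -> a \in T -> tree_into T i k.+1 m ->
  exists u v (T1 T2 : {set arrow n N}),
    [/\ m = u ++ v \/ m = v ++ u, tree_into T1 i k u, tree_into T2 i' k' v
      & T = a |: (T1 :|: T2)].
Proof.
move=> dT aT [um tl ex inj /(leaf_orderS_some _ dT aT ai ak)[u [v [lu lv muv]]]].
have [Uu Uv Uuv] := uniq_fork muv um.
have ru := leaf_order_root lu; have rv := leaf_order_root lv.
exists u, v, [set b in T | (tail b).1 \in u],
  [set b in T | ((tail b).1 \in v) && ((tail b).1 != i')]; split=> //.
- split=> //.
  + by move=> b; rewrite inE => /andP[bT bu]; split=> //; case: (tl b bT).
  + move=> p pu pi; have [|b bT bp] := ex p _ pi; first by rewrite (mem_fork muv) pu.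
    by exists b => //; rewrite inE bT bp.
  + by move=> b c; rewrite !inE => /andP[bT _] /andP[cT _]; apply: inj.
  + apply: (leaf_order_agree Uu lu) => b bu bi; rewrite inE.
    case: (boolP (b \in T)) => //= bT; apply/esym.
    have [] := tl b bT; rewrite (mem_fork muv) => /orP[//|bv _].
    have [e|/eqP ne] := eqVneq (tail b).1 i'.
      by move: bi; rewrite (inj _ _ bT aT e) ak ltnn => /(_ ai).
    have [bv' _ _ _] := leaf_order_head Uv lv inj bT bv ne.
    by case: (Uuv _ bu bv').
- split=> //.
  + by move=> b; rewrite inE => /and3P[bT bv /eqP].
  + move=> p pv pi; have [||b bT bp] := ex p; first by rewrite (mem_fork muv) pv orbT.
      by move=> e; apply: (Uuv p) => //; rewrite e.
    by exists b => //; rewrite inE bT bp pv; apply/eqP.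
  + by move=> b c; rewrite !inE => /andP[bT _] /andP[cT _]; apply: inj.
  + apply: (leaf_order_agree Uv lv) => b bv bi; rewrite inE.
    case: (boolP (b \in T)) => //= bT; apply/esym.
    have [bm ni] := tl b bT.
    have [e|_] := eqVneq (tail b).1 i'.
      by case: (Uuv i) => //; rewrite -ai -(inj _ _ bT aT e).
    rewrite andbT; move: bm; rewrite (mem_fork muv) => /orP[bu|//].
    have [bu' _ _ _] := leaf_order_head Uu lu inj bT bu ni.
    by case: (Uuv _ bu' bv).
- apply/setP => b; rewrite !inE; apply/idP/idP => [bT|]; last first.
    by case/or3P => [/eqP->|/andP[]|/andP[]].
  rewrite bT /=; have [bm _] := tl b bT.
  case: (eqVneq b a) => //= ba; have ne : (tail b).1 != i'.
    by apply: contra ba => /eqP e; apply/eqP/inj.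
  by rewrite ne andbT -(mem_fork muv).
Qed.

End Fork.

End LeafOrder.

Lemma sum_bij (V : nmodType) (I J : finType) (P : pred I) (Q : pred J) (f : I -> J)
    (F : I -> V) (H : J -> V) :
  (forall x, P x -> Q (f x) /\ H (f x) = F x) ->
  {in P &, injective f} ->
  (forall y, Q y -> exists2 x, P x & f x = y) ->
  \sum_(y | Q y) H y = \sum_(x | P x) F x.
Proof.
move=> PQ inj sur.
rewrite (eq_bigl (mem (f @: P))) => [|y]; last first.
  apply/idP/imsetP => [/sur[x Px <-]|[x Px ->]]; first by exists x.
  by case: (PQ x Px).
by rewrite big_imset //; apply: eq_bigr => x /PQ[].
Qed.

Lemma distinct_endsS n N (D E : {set arrow n N}) :
  E \subset D -> distinct_ends D -> distinct_ends E.
Proof.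
move=> /fintype.subsetP ED dD; apply/forall_inP => a aE; apply/forall_inP => b bE.
apply/forallP => s; apply/forallP => t; apply/implyP => /eqP e.
by have [-> ->] := distinct_endsP dD (ED _ aE) (ED _ bE) e; rewrite !eqxx.
Qed.

(** * Signed count of the trees inside the Gauss diagram *)

Section TreeSum.
Variables (n : nat) (G : gauss n).
Local Notation arr := (arrow n (gheight G)).
Implicit Types (i : 'I_n) (k : nat) (m : seq 'I_n) (a b : arr).

(** Joins the sign of the crossing with the share of the arrow in [tree_sign], so that the sign of
    an embedded tree is a product over its arrows. *)
Definition weight a : int :=
  gsign a * (if ((tail a).1 < (head a).1)%N then -1 else 1).

Definition is_tree (i : 'I_n) (k : nat) (m : seq 'I_n) (T : {set arr}) : bool :=
  (T \subset garrows G) && `[< tree_into T i k m >].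

Definition tree_sum i k m : int :=
  \sum_(T : {set arr} | is_tree i k m T) \prod_(b in T) weight b.

Lemma tree_sum_notin i k m : i \notin m -> tree_sum i k m = 0.
Proof.
move=> im; apply: big_pred0 => T; apply/negP => /andP[_ /asboolP/tree_into_root].
by apply/negP.
Qed.

Lemma tree_sum0 i m : tree_sum i 0 m = (m == [:: i])%:R.
Proof.
rewrite /tree_sum; case: eqP => [->|ne]; last first.
  by apply: big_pred0 => T; apply/negP => /andP[_ /asboolP/tree_into0[]].
rewrite (big_pred1 set0) ?big_set0// => T; rewrite /is_tree.
apply/andP/eqP => [[_ /asboolP/tree_into0[]//]|->].
by rewrite sub0set; split=> //; apply/asboolP/tree_into0.
Qed.

Lemma tree_sumS_none i k m : arrow_into G i k = None ->
  tree_sum i k.+1 m = tree_sum i k m.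
Proof.
move=> E; apply: eq_bigl => T; rewrite /is_tree.
case: (boolP (T \subset _)) => //= /fintype.subsetP TG; apply: asbool_equiv_eq.
apply: tree_intoS => a /TG aG; exact: (arrow_into_none E aG).
Qed.

Lemma tree_sumS_notin i k m a : arrow_into G i k = Some a ->
  \sum_(T : {set arr} | is_tree i k.+1 m T && (a \notin T)) \prod_(b in T) weight b
  = tree_sum i k m.
Proof.
move=> E; have [aG ai ak] := arrow_into_some E; apply: eq_bigl => T.
rewrite /is_tree; case: (boolP (T \subset _)) => //= /fintype.subsetP TG.
apply/andP/asboolP => [[/asboolP tT aT]|tT].
  suff Hno b : b \in T -> (head b).1 = i -> (head b).2 <> k :> nat.
    exact/(tree_intoS _ Hno).
  move=> bT bi bk; case/negP: aT.
  by have := arrow_intoP (TG _ bT); rewrite bi bk E => -[->].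
have Hno := tree_into_no_head tT; split.
  by apply/asboolP/(tree_intoS _ Hno).
by apply/negP => /Hno /(_ ai); apply.
Qed.

(* [(true, k)] and [(false, k)] stand for the cuts of a monomial in front of its
   [k]-th letter with the trunk to the left and to the right. *)
Definition cut (x : bool * nat) (m : seq 'I_n) : seq 'I_n * seq 'I_n :=
  if x.1 then (take x.2 m, drop x.2 m) else (drop x.2 m, take x.2 m).

Lemma cutP x m : m = (cut x m).1 ++ (cut x m).2 \/ m = (cut x m).2 ++ (cut x m).1.
Proof. by case: x => -[] k; [left|right]; rewrite /= cat_take_drop. Qed.

Lemma cut_surj u v m : m = u ++ v \/ m = v ++ u ->
  exists x : bool * 'I_(size m).+1, cut (x.1, val x.2) m = (u, v).
Proof.
case=> ->.
  have lt : (size u < (size (u ++ v)).+1)%N by rewrite size_cat ltnS leq_addr.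
  by exists (true, Ordinal lt); rewrite /cut /= take_size_cat// drop_size_cat.
have lt : (size v < (size (v ++ u)).+1)%N by rewrite size_cat ltnS leq_addr.
by exists (false, Ordinal lt); rewrite /cut /= take_size_cat// drop_size_cat.
Qed.

(** Nonempty parts are essential: [(true, 0)] and [(false, size m)] cut off the same empty trunk
    part. Given them, the first letter of [m] tells on which side the trunk lies. *)
Lemma cut_inj m (x y : bool * 'I_(size m).+1) : uniq m ->
  let cx := cut (x.1, val x.2) m in let cy := cut (y.1, val y.2) m in
  (cx.1 != [::]) -> cx.2 != [::] -> cx.1 =i cy.1 -> cx.2 =i cy.2 -> x = y.
Proof.
case: x y => [s k] [t l] um /=.
have opp (r : seq 'I_n) (p q : nat) : uniq r -> take p r != [::] -> drop p r != [::] ->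
    take p r =i drop q r -> drop p r =i take q r -> False.
  case: r p q => [|z r] [|p] [|q] //= /andP[zr _] _ pr e1 e2.
    case: (drop p r) pr e2 => [//|w r'] _ /(_ w).
    by rewrite inE eqxx.
  by have := e1 z; rewrite inE eqxx /= => /esym/mem_drop; apply/negP.
have tk (p q : 'I_(size m).+1) : take p m =i take q m -> p = q.
  move=> e; apply/val_inj => /=.
  have := perm_size (uniq_perm (take_uniq p um) (take_uniq q um) e).
  by rewrite !size_takel// -ltnS.
have dr (p q : 'I_(size m).+1) : drop p m =i drop q m -> p = q.
  move=> e; apply/val_inj => /=.
  have := perm_size (uniq_perm (drop_uniq p um) (drop_uniq q um) e).
  rewrite !size_drop => eq.
  have [pm qm] : (p <= size m)%N /\ (q <= size m)%N.
    by rewrite -ltnS ltn_ord -ltnS ltn_ord.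
  by rewrite -(subKn pm) eq subKn.
case: s t => -[] /= n1 n2 e1 e2.
- by rewrite (tk _ _ e1).
- by case: (opp _ _ _ um n1 n2 e1 e2).
- by case: (opp _ _ _ um n2 n1 e2 e1).
- by rewrite (tk _ _ e2).
Qed.

Lemma tree_sumS_in i k m a : uniq m -> arrow_into G i k = Some a ->
  \sum_(T : {set arr} | is_tree i k.+1 m T && (a \in T)) \prod_(b in T) weight b
  = \sum_(x : bool * 'I_(size m).+1)
      let c := cut (x.1, val x.2) m in
      weight a * (tree_sum i k c.1 * tree_sum (tail a).1 (tail a).2 c.2).
Proof.
move=> um E; have [aG ai ak] := arrow_into_some E.
pose c (x : bool * 'I_(size m).+1) := cut (x.1, val x.2) m.
pose P (x : bool * 'I_(size m).+1) (T : {set arr} * {set arr}) :=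
  is_tree i k (c x).1 T.1 && is_tree (tail a).1 (tail a).2 (c x).2 T.2.
transitivity (\sum_x \sum_(T | P x T)
    (weight a * (\prod_(b in T.1) weight b * \prod_(b in T.2) weight b))); last first.
  apply: eq_bigr => x _ /=; rewrite /tree_sum big_distrlr/= pair_big_dep mulr_sumr.
  by apply: eq_bigr.
rewrite pair_big_dep /=.
have PP x T : P x T -> [/\ T.1 \subset garrows G, T.2 \subset garrows G,
    tree_into T.1 i k (c x).1, tree_into T.2 (tail a).1 (tail a).2 (c x).2
    & a |: (T.1 :|: T.2) \subset garrows G].
  case/andP => /andP[s1 /asboolP t1] /andP[s2 /asboolP t2]; split=> //.
  by rewrite !subUset sub1set aG s1.
have dsub (T : {set arr}) : T \subset garrows G -> distinct_ends T.
  by move=> /distinct_endsS; apply; apply: gaussP.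
apply: (sum_bij (f := fun y => a |: (y.2.1 :|: y.2.2))).
- move=> [x T] /= /PP[s1 s2 t1 t2 sT].
  have [tT _ aT dT _] := tree_into_join ai ak (dsub _ sT) um (cutP _ m) t1 t2.
  rewrite /is_tree sT setU11 asboolT//=; split=> //.
  rewrite big_setU1//= (eq_bigl [predU T.1 & T.2]) ?bigU// => b.
  by rewrite in_setU.
(* Injectivity: by [leaf_order_mem] the trunk leaves below the last head depend only on the common
   union, and the branch has the complementary leaves, so the cuts coincide. *)
- move=> [x T] [y U] /PP[/= s1 s2 t1 t2 sT] /PP[/= r1 r2 q1 q2 sU] /= eTU.
  have [_ l1 _ _ [T1 T2]] := tree_into_join ai ak (dsub _ sT) um (cutP _ m) t1 t2.
  have [_ l2 _ _ [U1 U2]] := tree_into_join ai ak (dsub _ sU) um (cutP _ m) q1 q2.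
  have e1 : (c x).1 =i (c y).1.
    by apply: leaf_order_mem (dsub _ sT) l1 _; rewrite eTU.
  have e2 : (c x).2 =i (c y).2.
    have M w z : (z \in m) = (z \in (c w).1) || (z \in (c w).2).
      exact: mem_fork (cutP _ m) z.
    have X w z : z \in (c w).1 -> z \in (c w).2 -> False.
      by have [_ _] := uniq_fork (cutP (w.1, val w.2) m) um; apply.
    move=> z; have := M x z; rewrite (M y) e1.
    case: (boolP (z \in (c y).1)) => [zy _|_ /= ->//].
    have /negP/negbTE-> : ~ z \in (c x).2 by apply: X; rewrite e1.
    by apply/esym/negP; apply: X zy.
  have xy : x = y.
    apply: cut_inj um _ _ e1 e2.
      by have := tree_into_root t1; rewrite /c; case: (cut _ _).1.
    by have := tree_into_root t2; rewrite /c; case: (cut _ _).2.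
  subst y; congr (_, _); move: T1 T2 U1 U2; rewrite eTU => T1 T2 U1 U2.
  by apply: injective_projections; [rewrite T1 -U1|rewrite T2 -U2].
- move=> T /andP[/andP[sT /asboolP tT] aT].
  have [u [v [T1 [T2 [muv t1 t2 eT]]]]] := tree_into_split ai ak (dsub _ sT) aT tT.
  have [x cx] := cut_surj muv.
  exists (x, (T1, T2)) => //=.
  have [s1 s2] : T1 \subset garrows G /\ T2 \subset garrows G.
    by move: sT; rewrite eT !subUset => /and3P[].
  by rewrite /P /is_tree /= /c cx s1 s2 !asboolT.
Qed.

Lemma tree_sumS i k m a : uniq m -> arrow_into G i k = Some a ->
  tree_sum i k.+1 m = tree_sum i k m +
    weight a * \sum_(l < (size m).+1)
      (tree_sum i k (take l m) * tree_sum (tail a).1 (tail a).2 (drop l m) +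
       tree_sum i k (drop l m) * tree_sum (tail a).1 (tail a).2 (take l m)).
Proof.
move=> um E; rewrite {1}/tree_sum (bigID (fun T : {set arr} => a \in T)) /=.
rewrite (tree_sumS_in um E) (tree_sumS_notin _ E) addrC; congr (_ + _).
rewrite -(pair_bigA _ (fun s (l : 'I_(size m).+1) => let c := cut (s, val l) m in
  weight a * (tree_sum i k c.1 * tree_sum (tail a).1 (tail a).2 c.2))) /=.
by rewrite big_bool /= -!mulr_sumr -mulrDr big_split.
Qed.

Lemma tree_sum_nil i k : tree_sum i k [::] = 0.
Proof. exact: tree_sum_notin. Qed.

Lemma arc_seriesS_coef i k m a : uniq m -> arrow_into G i k = Some a ->
  arc_series G i k.+1 m = arc_series G i k m + gsign a *
    \sum_(l < (size m).+1)
      (arc_series G i k (take l m) * arc_series G (tail a).1 (tail a).2 (drop l m) -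
       arc_series G i k (drop l m) * arc_series G (tail a).1 (tail a).2 (take l m)).
Proof.
move=> um E; rewrite (arc_seriesS_some E).
set A := arc_series G i k; set t := tail_series a; set D := arc_series _ _ (tail a).2.
have -> : (1 - t) * A * (1 + t) = A + (A * t - t * A).
  (* Both factors [t] lie in the ideal of the variable of the tail's string. *)
  have tAt : t * A * t = 0.
    apply: (supp_mul0 (i := (tail a).1)); last exact: supp_tail_series.
    by apply: suppMr; apply: supp_tail_series.
  by rewrite mulrDr mulr1 mulrBl mul1r mulrBl tAt subr0 -addrA [- _ + _]addrC.
rewrite !rserD rserN !rserM// -sumrB mulr_sumr; congr (_ + _).
apply: eq_bigr => l _; have tE m' : t m' = gsign a * D m'.
  rewrite /t /tail_series /gsign; case: gpos; first by rewrite mul1r.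
  by rewrite mulN1r.
by rewrite !tE mulrBr mulrCA; congr (_ - _); rewrite -mulrA [D _ * _]mulrC.
Qed.

Lemma tree_sum_arc_series i k m : sorted (fun p q : 'I_n => (p < q)%N) m ->
  tree_sum i k m = arc_series G i k m.
Proof.
move E: (size m) => M; elim/ltn_ind: M i k m E => M IHM i k m E sm.
have um : uniq m.
  apply: sorted_uniq sm => [p q r|p]; [exact: ltn_trans|exact: ltnn].
elim: k m E sm um => [|k IHk] m E sm um.
  by rewrite tree_sum0 arc_series0.
case A: (arrow_into G i k) => [a|]; last first.
  by rewrite (tree_sumS_none _ A) (arc_seriesS_none A) IHk.
rewrite (tree_sumS um A) (arc_seriesS_coef um A) IHk//; congr (_ + _).
rewrite /weight -mulrA; congr (_ * _); rewrite mulr_sumr; apply: eq_bigr => l _.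
have ltl p q : p \in take l m -> q \in drop l m -> (p < q)%N.
  have ltr : transitive (fun p q : 'I_n => (p < q)%N).
    by move=> x y z; apply: ltn_trans.
  move: sm; rewrite -{1}(cat_take_drop l m) (sorted_pairwise ltr) pairwise_cat.
  by case/and3P => /allrelP H _ _; apply: H.
(* The two extreme cuts contribute nothing, since no series has a constant term. Any other cut has
   two shorter parts, to which the outer induction applies. *)
have [l0|l0] := posnP l.
  rewrite l0 take0 drop0 !tree_sum_nil !(supp_nil (supp_arc_series _ _)).
  by rewrite !(mul0r, mulr0, addr0, subr0).
have [lm|lm] := ltnP l (size m); last first.
  rewrite take_oversize// drop_oversize// !tree_sum_nil.
  by rewrite !(supp_nil (supp_arc_series _ _)) !(mul0r, mulr0, addr0, subr0).
have [st sd] : (size (take l m) < M)%N /\ (size (drop l m) < M)%N.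
  by rewrite size_take size_drop lm -E lm ltn_subrL l0 (leq_trans _ lm).
rewrite !(IHM _ st _ _ _ erefl) ?take_sorted// !(IHM _ sd _ _ _ erefl) ?drop_sorted//.
have [aG -> ak] := arrow_into_some A.
have D0 j h s : j \notin s -> arc_series G j h s = 0.
  by move=> js; rewrite supp_arc_series// negb_and js orbT.
(* A nonzero product needs [i] in the trunk part and the string of the tail in the branch part, and
   the smaller of the two stands in front. So a right-pointing arrow keeps only the cut with the
   branch in front, whose sign is minus, and any other arrow only the cut with the trunk in
   front. *)
case: ltnP => ia.
  rewrite (_ : arc_series G i k (take l m) * _ = 0).
    by rewrite add0r sub0r mulN1r.
  have [it|/D0->] := boolP (i \in take l m); last by rewrite mul0r.
  rewrite (D0 (tail a).1) ?mulr0//; apply/negP => /(ltl _ _ it).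
  by rewrite ltnNge ltnW.
rewrite (_ : arc_series G i k (drop l m) * _ = 0) ?addr0 ?subr0 ?mul1r//.
have [id|/D0->] := boolP (i \in drop l m); last by rewrite mul0r.
rewrite (D0 (tail a).1) ?mulr0//; apply/negP => /ltl /(_ id).
by rewrite ltnNge ia.
Qed.

End TreeSum.

(** * Isomorphisms of arrow diagrams *)

Section Correspondence.
Variable n : nat.

(* The graph of an isomorphism of arrow diagrams. *)
Definition corr N M (A : {set arrow n N}) (T : {set arrow n M})
    (R : arrow n N -> arrow n M -> Prop) : Prop :=
  [/\ forall a b, R a b -> a \in A /\ b \in T,
      forall a, a \in A -> exists b, R a b,
      forall b, b \in T -> exists a, R a b
    & forall a a' b b', R a b -> R a' b' -> forall s t : bool,
        (endpt s a).1 = (endpt s b).1 /\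
        below (endpt s a) (endpt t a') = below (endpt s b) (endpt t b')].

Section Transfer.
Variables (N M : nat) (A : {set arrow n N}) (T : {set arrow n M}).
Variable R : arrow n N -> arrow n M -> Prop.
Hypothesis AT : corr A T R.

Lemma corr_string a b s : R a b -> (endpt s a).1 = (endpt s b).1.
Proof. by case: AT => _ _ _ iso ab; case: (iso _ _ _ _ ab ab s s). Qed.

Lemma corr_lt a a' b b' s t : R a b -> R a' b' ->
  (endpt s a).1 = (endpt t a').1 ->
  ((endpt s a).2 < (endpt t a').2)%N = ((endpt s b).2 < (endpt t b').2)%N.
Proof.
case: AT => _ _ _ iso ab ab' e; have [e1] := iso _ _ _ _ ab ab' s t.
rewrite /below -e1 -(corr_string t ab') e eqxx; exact.
Qed.

Lemma corr_functional a b b' : R a b -> R a b' -> b = b'.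
Proof.
move=> ab ab'.
have e s : endpt s b = endpt s b'.
  apply: injective_projections; first by rewrite -(corr_string s ab) (corr_string s ab').
  have le c c' : R a c -> R a c' -> ((endpt s c).2 <= (endpt s c').2)%N.
    by move=> ac ac'; rewrite leqNgt -(corr_lt (s := s) (t := s) ac' ac) ?ltnn.
  by apply/val_inj/eqP; rewrite eqn_leq; apply/andP; split; apply: le.
by apply: injective_projections; [exact: (e false)|exact: (e true)].
Qed.

Lemma corr_leaf_order i k k' u : leaf_order A i k u ->
  (forall a b, R a b -> (head a).1 = i ->
     ((head a).2 < k)%N = ((head b).2 < k')%N) ->
  leaf_order T i k' u.
Proof.
have [mem l r iso] := AT.
move=> lu; elim: lu k' => {i k u} [i k H|a k u v w aA ak H _ IHu _ IHv w_uv] k' kk.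
  apply: LeafStart => b /r[a ab] [bi bk].
  have ai : (head a).1 = i by rewrite (corr_string true ab).
  by case: (H a); [case: (mem _ _ ab)|rewrite (kk a b ab ai)].
have [b ab] := l a aA; have e := corr_string true ab; rewrite /= in e.
rewrite e; apply: (LeafFork (u := u) (v := v)) => //.
- by case: (mem _ _ ab).
- by rewrite -(kk a b ab).
- move=> b' /r[a' ab'] bb bk.
  have aa : (head a').1 = (head a).1 by rewrite e -bb (corr_string true ab').
  rewrite leqNgt -(corr_lt (s := true) (t := true) ab ab' (esym aa)) -leqNgt.
  by apply: H => //; [case: (mem _ _ ab')|rewrite (kk a' b' ab' aa)].
- rewrite -e; apply: IHu => a' b' ab' aa.
  exact: (corr_lt (s := true) (t := true) ab' ab).
- rewrite -(corr_string false ab); apply: IHv => a' b' ab' aa.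
  exact: (corr_lt (s := true) (t := false) ab' ab).
Qed.

End Transfer.

Lemma corr_tree_into N M (A : {set arrow n N}) (T : {set arrow n M}) R i m :
  corr A T R -> tree_into A i N m -> tree_into T i M m.
Proof.
move=> AT [um tl ex inj lm]; have [mem l r iso] := AT.
have str := corr_string AT; split=> //.
- by move=> b /r[a ab]; have := tl a (mem _ _ ab).1; rewrite (str a b false ab).
- move=> p pm pi; have [a /l[b ab] <-] := ex p pm pi.
  by exists b; [case: (mem _ _ ab)|rewrite (str a b false ab)].
- move=> b b' /r[a ab] /r[a' ab'] e; apply: (corr_functional AT ab).
  rewrite (inj a a') //; [by case: (mem _ _ ab)|by case: (mem _ _ ab')|].
  by rewrite (str a b false ab) (str a' b' false ab').
- by apply: (corr_leaf_order AT lm) => a b _ _; rewrite !ltn_ord.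
Qed.

Lemma arrow_diagramP N (A : {set arrow n N}) a s (q : point n N) :
  arrow_diagram A -> a \in A -> below q (endpt s a) ->
  exists b t, b \in A /\ endpt t b = q.
Proof.
case/andP=> _ /forall_inP H aA qa.
have /forallP/(_ s)/forallP/(_ q)/implyP/(_ qa) := H a aA.
by case/exists_inP => b bA /existsP[t /eqP bq]; exists b, t.
Qed.

(** Normalised heights have no gaps, so they are determined by the order: at the least height where
    matched ends differed, one diagram would have an end there with no partner left for it. *)
Lemma corr_diagram N (A A' : {set arrow n N}) R a b :
  arrow_diagram A -> arrow_diagram A' -> corr A A' R -> R a b -> a = b.
Proof.
move=> dA dA' AA; have [mem l r iso] := AA.
suff H h s a' b' : R a' b' -> (endpt s a').2 = h :> nat -> (endpt s b').2 = h :> nat.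
  move=> ab; have e s : endpt s a = endpt s b.
    apply: injective_projections; first exact: (corr_string AA).
    by apply/val_inj/esym; apply: H ab _.
  by apply: injective_projections; [exact: (e false)|exact: (e true)].
elim/ltn_ind: h s a' b' => h IH s a' b' ab ah.
have [lt|gt|//] := ltngtP (endpt s b').2 h.
  have [|c [t [cA cq]]] :=
      arrow_diagramP (s := s) (q := ((endpt s a').1, (endpt s b').2))
        dA (mem _ _ ab).1.
    by rewrite /below /= eqxx ah.
  have [d cd] := l c cA.
  have ch : (endpt t c).2 = (endpt s b').2 by rewrite cq.
  have dh := IH _ lt t c d cd (congr1 val ch).
  have := corr_lt (s := t) (t := s) AA cd ab; rewrite ch ah lt dh ltnn.
  by rewrite cq => /(_ erefl).
have hN : (h < N)%N by rewrite -ah ltn_ord.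
have [|d [t [dd dq]]] :=
    arrow_diagramP (s := s) (q := ((endpt s b').1, Ordinal hN)) dA' (mem _ _ ab).2.
  by rewrite /below /= eqxx.
have [c cd] := r d dd.
have e : (endpt t c).1 = (endpt s a').1.
  by rewrite (corr_string AA t cd) dq (corr_string AA s ab).
have lt : ((endpt t c).2 < h)%N.
  by rewrite -ah (corr_lt (s := t) (t := s) AA cd ab e) dq.
have := IH _ lt t c d cd erefl; rewrite dq /= => eh.
by rewrite -eh ltnn in lt.
Qed.

End Correspondence.

(** * Tree diagrams as trees flowing into the trunk *)

Section TreeDiagrams.
Variables (n N : nat).
Implicit Types (A T : {set arrow n N}).

(** Every head on a string reached by the reading precedes the tail through which the string was
    reached, so its arrow is read as well. *)
Lemma leaf_order_closed T i k u : distinct_ends T ->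
  (forall a b, a \in T -> b \in T -> (head a).1 = (tail b).1 ->
     ((head a).2 < (tail b).2)%N) ->
  leaf_order T i k u ->
  forall b, b \in T -> (head b).1 \in u -> ((head b).1 = i -> ((head b).2 < k)%N) ->
  (tail b).1 \in u.
Proof.
move=> dT ht; elim=> {i k u} [i k H|a k u v w aT ak H lu IHu lv IHv w_uv] b bT.
  by rewrite mem_seq1 => /eqP bi /(_ bi) bk; case: (H b bT).
rewrite !(mem_fork w_uv) => /orP[bu|bv] bk; last first.
  by rewrite IHv ?orbT// => e; apply: ht.
have [e|/eqP ne] := eqVneq (head b).1 (head a).1; last by rewrite IHu.
have := H b bT e (bk e); rewrite leq_eqVlt => /predU1P[h|lt]; last by rewrite IHu.
by rewrite (head_inj dT bT aT e h) (leaf_order_root lv) orbT.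
Qed.

Lemma leaf_order_sub T i k u p : leaf_order T i k u -> p \in u ->
  p = i \/ exists2 a, a \in T & (tail a).1 = p.
Proof.
elim=> {i k u} [i k H|a k u v w aT ak H lu IHu lv IHv w_uv].
  by rewrite mem_seq1 => /eqP; left.
rewrite (mem_fork w_uv) => /orP[/IHu//|/IHv[->|]]; last by right.
by right; exists a.
Qed.

Definition arrow_rel A : rel 'I_n :=
  [rel p q | [exists a in A, ((tail a).1 == p) && ((head a).1 == q)]].

Lemma leaf_order_connect T i k u p : leaf_order T i k u -> p \in u ->
  connect (arrow_rel T) p i.
Proof.
elim=> {i k u} [i k H|a k u v w aT ak H lu IHu lv IHv w_uv].
  by rewrite mem_seq1 => /eqP->.
rewrite (mem_fork w_uv) => /orP[/IHu//|/IHv pa].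
apply: connect_trans pa (connect1 _).
by apply/exists_inP; exists a; rewrite // !eqxx.
Qed.

Lemma tree_into_diagram A (j : 'I_n) (s : seq 'I_n) :
  path (fun a b : 'I_n => (a < b)%N) j s ->
  (arrow_diagram A /\ tree_into A j N (j :: s)) <->
  (tree_diagram [set i in s] j A /\ planar A j).
Proof.
move=> js.
have ltr : transitive (fun a b : 'I_n => (a < b)%N) by move=> x y z; apply: ltn_trans.
have irr : irreflexive (fun a b : 'I_n => (a < b)%N) by move=> x; apply: ltnn.
have us : uniq (j :: s) by apply: (sorted_uniq ltr irr (s := j :: s)).
have jNs : j \notin s by case/andP: us.
split=> [[dA tA]|[/and5P[dA _ cnt _ /andP[ht con]] [u lu su]]].
  have [_ tl ex inj lA] := tA; split; last by exists (j :: s).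
  have hd b bA := tree_into_head (b := b) tA bA.
  apply/and5P; split=> //; last (apply/andP; split).
  - by apply/forall_inP => a /hd[].
  - apply/forallP => i; rewrite inE; apply/eqP; case: (boolP (i \in s)) => si.
      have [||a aA ai] := ex i; first by rewrite inE si orbT.
        by move=> ij; rewrite -ij si in jNs.
      transitivity #|[set a]|; last by rewrite cards1.
      apply: eq_card => b; rewrite !inE.
      by apply/andP/eqP => [[bA /eqP bi]|->]; [apply: inj; rewrite ?ai|rewrite aA ai].
    apply/eqP; rewrite cards_eq0 -subset0; apply/fintype.subsetP => b.
    rewrite !inE => /andP[/tl[+ bj] /eqP bi].
    by rewrite bi inE (negbTE si) orbF => /eqP; rewrite -bi.
  - by apply/forall_inP => a /hd[+ _ _ _]; rewrite !inE.
  - apply/forall_inP => a aA; apply/forall_inP => b bA; apply/implyP => /eqP ab.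
    have [_ bj] := tl b bA; have [_ _ _ []] := hd a aA; first by rewrite ab.
    by move=> c cA [ca lt]; rewrite /below ab eqxx -(inj c b)// ca.
  - apply/forall_inP => i; rewrite inE => si.
    by apply: (leaf_order_connect lA); rewrite inE si orbT.
have card1 i : #|[set a in A | (tail a).1 == i]| = (i \in s).
  by have := forallP cnt i; rewrite inE => /eqP.
have mem_tl a : a \in A -> (tail a).1 \in s.
  move=> aA; have := card1 (tail a).1; case: (_ \in s) => // /eqP.
  by rewrite cards_eq0 => /eqP/setP/(_ a); rewrite !inE aA eqxx.
have {}ht a b : a \in A -> b \in A -> (head a).1 = (tail b).1 ->
    ((head a).2 < (tail b).2)%N.
  move=> aA bA /eqP ab; have /forall_inP/(_ b bA) := forall_inP ht a aA.
  by rewrite ab /= => /andP[].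
have de : distinct_ends A by case/andP: dA.
(* Both sequences are increasing, so equal contents suffice. A string of [s] is reached because
   [con] gives a path of arrows to [j], which [leaf_order_closed] follows backwards. *)
have us' : u = j :: s.
  apply: (irr_sorted_eq ltr irr) => // p; apply/idP/idP => [pu|].
    have [->|[a /mem_tl + ap]] := leaf_order_sub lu pu; first by rewrite inE eqxx.
    by rewrite ap inE => ->; rewrite orbT.
  rewrite inE => /predU1P[->|ps]; first exact: leaf_order_root lu.
  have /forall_inP/(_ p) := con; rewrite inE => /(_ ps)/connectP[q].
  elim: q p {ps} => [|x q IHq] p /=; first by move=> _ <-; apply: leaf_order_root lu.
  move=> /andP[/exists_inP[a aA /andP[/eqP <- /eqP ax]] xq] jq.
  apply: (leaf_order_closed de ht lu) => //.
  by rewrite ax; apply: IHq.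
subst u; split; first exact: dA.
split=> //.
- move=> a /mem_tl ta; split; first by rewrite inE ta orbT.
  by move=> e; rewrite -e ta in jNs.
- move=> p; rewrite inE => /predU1P[->//|ps _].
  have /eqP/cards1P[a ea] : #|[set a in A | (tail a).1 == p]| = 1%N by rewrite card1 ps.
  have : a \in [set a in A | (tail a).1 == p] by rewrite ea inE.
  by rewrite inE => /andP[aA /eqP]; exists a.
- move=> a b aA bA e.
  have /card_le1_eqP H : (#|[set c in A | (tail c).1 == (tail a).1]| <= 1)%N.
    by rewrite card1; case: (_ \in _).
  by apply: H; rewrite inE ?aA ?bA ?e eqxx.
Qed.

End TreeDiagrams.

(** * Normalising the heights of a subdiagram *)

Section Normalise.
Variables (n N : nat) (j : 'I_n) (T : {set arrow n N}).
Hypothesis dT : distinct_ends T.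
Hypothesis tail_head : forall a, a \in T -> (tail a).1 != (head a).1.
Hypothesis cardT : (#|T| < n)%N.

Definition ends_below (p : point n N) : {set arrow n N} :=
  [set b in T | [exists s, below (endpt s b) p]].

(* An arrow has at most one end on each string, so counting arrows is counting
   ends. *)
Definition rank (p : point n N) : nat := #|ends_below p|.

(** Every rank is at most [#|T|], hence below [n], so [insubd] returns the rank itself;
    [norm_height] records this. *)
Definition norm_point (p : point n N) : point n n := (p.1, insubd j (rank p)).

Definition norm_arrow (a : arrow n N) : arrow n n :=
  (norm_point (tail a), norm_point (head a)).

Lemma endpt_norm s a : endpt s (norm_arrow a) = norm_point (endpt s a).
Proof. by case: s. Qed.

Lemma norm_height p : (norm_point p).2 = rank p :> nat.
Proof.
rewrite /norm_point /= val_insubd (leq_ltn_trans _ cardT)//.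
by apply: subset_leq_card; apply/fintype.subsetP => b; rewrite inE => /andP[].
Qed.

Lemma rank_lt a s q : a \in T -> below (endpt s a) q -> (rank (endpt s a) < rank q)%N.
Proof.
move=> aT aq; apply: proper_card; apply/properP; split.
  apply/fintype.subsetP => b; rewrite !inE => /andP[-> /existsP[t /andP[/eqP e lt]]] /=.
  case/andP: aq => /eqP e' lt'; apply/existsP; exists t.
  by rewrite /below e e' eqxx (ltn_trans lt).
exists a; rewrite inE aT /=; first by apply/existsP; exists s.
apply/negP => /existsP[t /andP[/eqP e lt]]; have := tail_head aT.
by case: s t e lt {aq} => -[] /= e; rewrite ?ltnn// e eqxx.
Qed.

Lemma below_norm a b s t : a \in T -> b \in T ->
  below (endpt s (norm_arrow a)) (endpt t (norm_arrow b)) =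
  below (endpt s a) (endpt t b).
Proof.
move=> aT bT; rewrite !endpt_norm {1}/below !norm_height /=.
rewrite [RHS]/below; case: eqP => //= e.
apply/idP/idP => lt; last first.
  by apply: rank_lt => //; rewrite /below e eqxx.
rewrite ltnNge leq_eqVlt; apply/negP => /predU1P[h|lt'].
  have E : endpt s a = endpt t b.
    by apply: injective_projections => //; apply/val_inj/esym.
  by rewrite E ltnn in lt.
suff : (rank (endpt t b) < rank (endpt s a))%N by rewrite ltnNge ltnW.
by apply: rank_lt => //; rewrite /below e eqxx.
Qed.

Lemma norm_endpt_inj a b s t : a \in T -> b \in T ->
  endpt s (norm_arrow a) = endpt t (norm_arrow b) -> a = b /\ s = t.
Proof.
move=> aT bT e; apply: (distinct_endsP dT) => //.
have e1 : (endpt s a).1 = (endpt t b).1.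
  by have := congr1 fst e; rewrite !endpt_norm.
have le c d r q : c \in T -> d \in T -> (endpt r c).1 = (endpt q d).1 ->
    endpt r (norm_arrow c) = endpt q (norm_arrow d) ->
    ((endpt q d).2 <= (endpt r c).2)%N.
  move=> cT dT' e2 e3; rewrite leqNgt; have := below_norm r q cT dT'.
  by rewrite e3 /below e2 !eqxx ltnn /= => <-.
apply: injective_projections => //; apply/val_inj/eqP.
by rewrite eqn_leq !le.
Qed.

Lemma rank_attained h a s : a \in T -> (h < rank (endpt s a))%N ->
  exists b t, [/\ b \in T, (endpt t b).1 = (endpt s a).1 & rank (endpt t b) = h].
Proof.
move E: (nat_of_ord (endpt s a).2) => k; elim/ltn_ind: k a s E => k IH a s E aT hr.
pose P (x : arrow n N * bool) := (x.1 \in T) && below (endpt x.2 x.1) (endpt s a).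
have [x0 Px0] : exists x, P x.
  have : (0 < rank (endpt s a))%N by apply: leq_ltn_trans hr.
  case/card_gt0P => b; rewrite inE => /andP[bT /existsP[t bt]].
  by exists (b, t); rewrite /P bT.
case: (@arg_maxnP _ x0 P (fun x => (endpt x.2 x.1).2) Px0) => -[b t].
move=> /andP[/= bT /andP[/eqP e lt]] bmax.
(* As [b] carries the highest end below [endpt s a], any other arrow ending below that point already
   ends below [endpt t b]. So the rank grows by at most one from end to end and skips no value. *)
have : (rank (endpt s a) <= (rank (endpt t b)).+1)%N.
  rewrite -add1n -[X in (X + _)%N](cards1 b) (leq_trans _ (leq_card_setU _ _))//.
  apply: subset_leq_card; apply/fintype.subsetP => c.
  rewrite !inE => /andP[cT /existsP[r cr]]; rewrite cT /=.
  have := bmax (c, r); rewrite /P cT cr => /(_ isT) /=.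
  have e' : (endpt r c).1 = (endpt t b).1 by case/andP: cr => /eqP ->.
  rewrite leq_eqVlt => /orP[/eqP h2|lt2].
    have [-> _] : c = b /\ r = t.
      apply: (distinct_endsP dT) => //.
      by apply: injective_projections => //; apply/val_inj.
    by rewrite eqxx.
  by apply/orP; right; apply/existsP; exists r; rewrite /below e' eqxx.
move=> /(leq_trans hr); rewrite ltnS leq_eqVlt => /predU1P[->|hb].
  by exists b, t.
have [|c [r [cT ce cr]]] := IH _ _ b t erefl bT hb; first by rewrite -E.
by exists c, r; rewrite ce e.
Qed.

Lemma norm_diagram : arrow_diagram (norm_arrow @: T).
Proof.
apply/andP; split.
  apply/forall_inP => _ /imsetP[a aT ->]; apply/forall_inP => _ /imsetP[b bT ->].
  apply/forallP => s; apply/forallP => t; apply/implyP => /eqP /norm_endpt_inj.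
  by move=> /(_ aT bT)[-> ->]; rewrite !eqxx.
apply/forall_inP => _ /imsetP[a aT ->]; apply/forallP => s; apply/forallP => q.
apply/implyP => /andP[/eqP qa]; rewrite endpt_norm norm_height => lt.
have [b [t [bT eb rb]]] := rank_attained aT lt.
apply/exists_inP; exists (norm_arrow b); first by apply: imset_f.
apply/existsP; exists t; apply/eqP; rewrite endpt_norm.
apply: injective_projections; first by rewrite qa endpt_norm.
by apply/val_inj; rewrite /= norm_height.
Qed.

Lemma norm_corr : corr T (norm_arrow @: T) (fun a b => a \in T /\ b = norm_arrow a).
Proof.
split.
- by move=> a _ [aT ->]; split=> //; apply: imset_f.
- by move=> a aT; exists (norm_arrow a).
- by move=> _ /imsetP[a aT ->]; exists a.
- move=> a a' _ _ [aT ->] [aT' ->] s t; rewrite below_norm//; split=> //.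
  by rewrite endpt_norm.
Qed.

End Normalise.

(** * Embedded tree diagrams as sets of arrows *)

Section Embeddings.
Variables (n : nat) (G : gauss n) (j : 'I_n) (s : seq 'I_n).
Hypothesis js : path (fun a b : 'I_n => (a < b)%N) j s.
Local Notation arr := (arrow n (gheight G)).
Local Notation emb A := {ffun {a : arrow n n | a \in A} -> arr}.

Lemma planar_treesP A :
  reflect (arrow_diagram A /\ tree_into A j n (j :: s))
    (A \in planar_trees [set i in s] j).
Proof.
apply: (iffP idP); rewrite inE.
  by move=> /andP[tA /asboolP pA]; apply/(tree_into_diagram _ js).
by move=> /(tree_into_diagram _ js)[-> ?]; apply/asboolP.
Qed.

Lemma embedding_corr (A : {set arrow n n}) (phi : emb A) : is_embedding phi ->
  corr A [set phi a | a in setT] (fun a b => exists x, val x = a /\ phi x = b).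
Proof.
move=> /andP[_ /forallP H]; split.
- by move=> _ _ [x [<- <-]]; split; [exact: valP|exact: imset_f].
- by move=> a aA; exists (phi (exist _ a aA)); exists (exist _ a aA).
- by move=> _ /imsetP[x _ ->]; exists (val x); exists x.
- move=> _ _ _ _ [x [<- <-]] [y [<- <-]] r t.
  by have /forallP/(_ y)/forallP/(_ r)/forallP/(_ t)/andP[/eqP-> /eqP->] := H x.
Qed.

Lemma embedding_weight (A : {set arrow n n}) (phi : emb A) :
  A \in planar_trees [set i in s] j -> is_embedding phi ->
  \prod_(b in [set phi a | a in setT]) weight b =
  tree_sign A * \prod_a gsign (phi a).
Proof.
move=> /planar_treesP[dA [_ _ _ inj _]] ephi; have cphi := embedding_corr ephi.
have str x t : (endpt t (phi x)).1 = (endpt t (val x)).1.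
  by rewrite (corr_string cphi (a := val x) (b := phi x))//; exists x.
have iphi : {in setT &, injective phi}.
  move=> x y _ _ e; apply/val_inj/inj; rewrite ?(valP x) ?(valP y)//.
  by rewrite -(str x false) -(str y false) e.
rewrite big_imset//= (eq_bigl predT) => [|x]; last by rewrite inE.
rewrite big_split mulrC /=; congr (_ * _).
rewrite (eq_bigr (fun x : {a | a \in A} =>
  (fun a : arrow n n => if ((tail a).1 < (head a).1)%N then -1 else 1) (val x))).
  rewrite -(big_sub A (fun a => if ((tail a).1 < (head a).1)%N then -1 else 1)).
  rewrite -big_mkcondr /tree_sign -prodr_const; apply: eq_bigl => a.
  by rewrite inE.
by move=> x _; have := (str x false, str x true) => /= -[-> ->].
Qed.

(** Two embedded diagrams with the same image are isomorphic through it, hence equal by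
    [corr_diagram], and then so are the embeddings. Conversely a tree in [G] is the image of its
    normalisation. *)
Lemma Z_tree_sum : Z [set i in s] j G = tree_sum G j (gheight G) (j :: s).
Proof.
rewrite /Z /pairing (eq_bigr (fun A : {set arrow n n} =>
  \sum_(phi : emb A | is_embedding phi)
    (tree_sign A * \prod_a gsign (phi a)))); last by move=> A _; rewrite mulr_sumr.
rewrite (sig_big_dep (J := fun A : {set arrow n n} => emb A : finType)
  (mem (planar_trees [set i in s] j))
  (fun (A : {set arrow n n}) (phi : emb A) => is_embedding phi)
  (fun (A : {set arrow n n}) (phi : emb A) => tree_sign A * \prod_a gsign (phi a))) /=.
pose image (p : {A : {set arrow n n} & emb A}) := [set tagged p a | a in setT].
rewrite /tree_sum; symmetry; apply: (sum_bij (f := image)); rewrite /image.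
- move=> [A phi] /= /andP[PA ephi]; rewrite embedding_weight//; split=> //.
  have [dA tA] := planar_treesP _ PA; apply/andP; split; last first.
    exact/asboolP/(corr_tree_into (embedding_corr ephi)).
  by apply/fintype.subsetP => _ /imsetP[x _ ->]; case/andP: ephi => /forallP.
- move=> [A phi] [B psi] /andP[/= /planar_treesP[dA tA] ephi].
  move=> /andP[/= /planar_treesP[dB tB] epsi] im.
  have [cA cB] := (embedding_corr ephi, embedding_corr epsi).
  pose R a b := exists x y, [/\ val x = a, val y = b & phi x = psi y].
  have cAB : corr A B R.
    split.
    + by move=> _ _ [x [y [<- <- _]]]; split; apply: valP.
    + move=> a aA; have : phi (exist _ a aA) \in [set psi x | x in setT].
        by rewrite -im; apply: imset_f.
      by case/imsetP => y _ e; exists (val y), (exist _ a aA), y.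
    + move=> b bB; have : psi (exist _ b bB) \in [set phi x | x in setT].
        by rewrite im; apply: imset_f.
      by case/imsetP => x _ e; exists (val x), x, (exist _ b bB).
    + move=> _ _ _ _ [x [y [<- <- e]]] [x' [y' [<- <- e']]] r t.
      have [_ _ _ isoA] := cA; have [_ _ _ isoB] := cB.
      have [|//|-> ->] := isoA (val x) (val x') (phi x) (phi x') _ _ r t.
        by exists x.
        by exists x'.
      have [|//|-> ->] := isoB (val y) (val y') (psi y) (psi y') _ _ r t.
        by exists y.
        by exists y'.
      by rewrite e e'.
  have eR a b : R a b -> a = b by apply: corr_diagram cAB.
  have AB : A = B.
    have [mem l r _] := cAB; apply/setP => a; apply/idP/idP => aA.
      by have [b ab] := l a aA; rewrite (eR _ _ ab); case: (mem _ _ ab).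
    by have [b ab] := r a aA; rewrite -(eR _ _ ab); case: (mem _ _ ab).
  subst B; congr existT; apply/ffunP => x.
  have : phi x \in [set psi x | x in setT] by rewrite -im; apply: imset_f.
  case/imsetP => y _ e; rewrite e; congr (psi _); apply/esym/val_inj/eR.
  by exists x, y.
- move=> T /andP[TG /asboolP tT].
  have dT := distinct_endsS TG (gaussP G).
  have hT a : a \in T -> (tail a).1 != (head a).1.
    by move=> /(tree_into_head tT)[].
  (* The tails lie on distinct strings other than [j]. *)
  have cT : (#|T| < n)%N.
    have [_ tl _ inj _] := tT.
    rewrite -(card_in_imset inj) -[X in (_ < X)%N](card_ord n).
    rewrite -[X in (_ < X)%N]cardsT proper_card// properT.
    apply/negP => /eqP /setP/(_ j); rewrite inE => /imsetP[a /tl[_ aj] ja].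
    exact: aj.
  have cN := norm_corr j hT cT; pose A := norm_arrow j T @: T.
  have [phi phiP] : exists phi : {a | a \in A} -> arr,
      forall x, phi x \in T /\ norm_arrow j T (phi x) = val x.
    have H (x : {a | a \in A}) : exists b, b \in T /\ norm_arrow j T b = val x.
      by have /imsetP[b bT ->] := valP x; exists b.
    by have [f fP] := choice H; exists f.
  exists (Tagged (fun A : {set arrow n n} => emb A) (finfun phi)); last first.
    apply/setP => b /=; apply/imsetP/idP => [[x _ ->]|bT].
      by rewrite ffunE; case: (phiP x).
    have bA : norm_arrow j T b \in A by apply: imset_f.
    pose x : {a | a \in A} := exist (fun a => a \in A) _ bA.
    exists x; first by rewrite inE.
    rewrite ffunE; have [pT e] := phiP x.
    have H : endpt true (norm_arrow j T b) = endpt true (norm_arrow j T (phi x)).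
      by rewrite e.
    by have [->] := norm_endpt_inj dT hT cT bT pT H.
  apply/andP; split=> /=.
    apply/planar_treesP; split; first exact: norm_diagram.
    exact: (corr_tree_into cN).
  apply/andP; split.
    apply/forallP => x; rewrite ffunE; apply: (fintype.subsetP TG).
    by case: (phiP x).
  apply/forallP => x; apply/forallP => y; apply/forallP => r; apply/forallP => t.
  have [[xT ex] [yT ey]] := (phiP x, phiP y); rewrite !ffunE.
  have [_ _ _ iso] := cN.
  have [|//|-> ->] := iso (phi x) (phi y) (val x) (val y) _ _ r t => //.
  by rewrite !eqxx.
Qed.

End Embeddings.

Theorem theorem4p6 (n : nat) (L : virtual_tangle n) (G : gauss n)
    (j : 'I_n) (s : seq 'I_n) :
  represents L G ->
  path (fun a b : 'I_n => (a < b)%N) j s ->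
  Z [set i in s] j G = mu s j G.
Proof.
move=> _ js; rewrite (Z_tree_sum G js) tree_sum_arc_series// mu_arc_series//.
apply: (@sorted_uniq _ (fun a b : 'I_n => (a < b)%N) _ _ (j :: s)) => //.
  by move=> x y z; apply: ltn_trans.
by move=> x; apply: ltnn.
Qed.
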